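(* For all $r, q, R \in \mathbb{N}$ and $K_0, \varepsilon > 0$ there exists $C' = C'(\varepsilon, r, q, R, K_0)$ such that the following holds. Let $n, k \in \mathbb{N}$ satisfy $3k - K_0 \le n \le Rk + K_0$, and let $f$ be an $n$-variable multilinear polynomial of degree at most $r$ with coefficients in $\mathbb{Z} \cap [-q,q]$. Then for each $\ell \in \mathbb{R}$, at least one of the following holds: (1) $\mathbb{P}[f(\vec\sigma) = \ell] \le \varepsilon$, where $\vec\sigma \sim \mathrm{Slice}(n,k)$; (2) there exist disjoint sets $Y_0, Y_1 \subseteq [n]$, each of size at most $C'$, such that $f_{Y_0,Y_1}$ is constantly $\ell$ on $\mathrm{Slice}(n - |Y_0| - |Y_1|, k - |Y_1|)$.
   Context: $\mathrm{Slice}(n,k)$ is the set of vectors in $\{0,1\}^n$ with exactly $k$ ones; $\vec\sigma \sim \mathrm{Slice}(n,k)$ is uniformly random in it. For disjoint $Y_0, Y_1 \subseteq [n]$, $f_{Y_0,Y_1}$ is the polynomial in the remaining $n - |Y_0| - |Y_1|$ variables obtained from $f$ by setting all variables indexed by $Y_0$ to $0$ and all indexed by $Y_1$ to $1$. A multilinear polynomial $g$ in $N$ variables of degree at most $r$ is called constantly $\ell$ on $\mathrm{Slice}(N, k')$ if for every $0 \le d \le r$ all $\binom{N}{d}$ coefficients of its degree-$d$ multilinear monomials are equal to a common value $\ell_d \in \mathbb{R}$, and $\sum_{d=0}^{r} \ell_d \binom{k'}{d} = \ell$. *)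

(* Defs.v *)
From mathcomp Require Export all_boot all_order all_algebra.
From mathcomp Require Export reals mpoly.

Set Implicit Arguments.
Unset Strict Implicit.
Unset Printing Implicit Defensive.

Export Order.TTheory GRing.Theory Num.Theory.

Local Open Scope ring_scope.

Definition slice (n k : nat) : {set {ffun 'I_n -> bool}} :=
  [set x : {ffun 'I_n -> bool} | #|[set i | x i]| == k].

(* If the slice is empty, that is if k > n, the value is 0 since x / 0 = 0. *)
Definition slice_prob (F : realType) (n k : nat)
    (A : pred {ffun 'I_n -> bool}) : F :=
  #|[set x in slice n k | A x]|%:R / #|slice n k|%:R.
Arguments slice_prob F n k A : clear implicits.

Definition eval01 (F : realType) (n : nat) (f : {mpoly F[n]})
    (x : {ffun 'I_n -> bool}) : F :=
  f.@[fun i => (x i)%:R].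

Definition multilinear_mnm (n : nat) (m : 'X_{1..n}) : bool :=
  [forall i, (m i <= 1)%N].

Definition multilinear (F : realType) (n : nat) (f : {mpoly F[n]}) : Prop :=
  forall m, m \in msupp f -> multilinear_mnm m.

(* [msize f] is the total degree plus one, and 0 for f = 0. *)
Definition degree_le (F : realType) (n r : nat) (f : {mpoly F[n]}) : bool :=
  (msize f <= r.+1)%N.

(* The polynomial f_{Y0,Y1}. Its variables are the elements of the complement
   W of Y0 :|: Y1, numbered increasingly: the j-th one stands for the variable
   [enum_val j] of f. For i in W the sum has the single term 'X_j with
   [enum_val j = i]. *)
Definition restrict (F : realType) (n : nat) (Y0 Y1 : {set 'I_n})
    (f : {mpoly F[n]}) : {mpoly F[#|~: (Y0 :|: Y1)|]} :=
  f \mPo [tuple if i \in Y0 then 0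
                else if i \in Y1 then 1
                else \sum_(j : 'I_#|~: (Y0 :|: Y1)| | enum_val j == i) 'X_j
         | i < n].

(* "g is constantly l on Slice(N, k')". For N < d <= r there is no monomial and
   c d is free, which is harmless when k' <= N because then 'C(k', d) = 0. *)
Definition constantly (F : realType) (N r k' : nat) (l : F)
    (g : {mpoly F[N]}) : Prop :=
  [/\ multilinear g, degree_le r g &
      exists c : nat -> F,
        (forall d, (d <= r)%N ->
           forall m : 'X_{1..N}, multilinear_mnm m -> mdeg m = d ->
             g@_m = c d) /\
        \sum_(d < r.+1) c d * 'C(k', d)%:R = l].

(* Main.v *)
Require Import Defs.
From mathcomp Require Import all_boot all_order all_algebra.
From mathcomp Require Import reals mpoly.
From mathcomp Require Import zify ring lra.
From Stdlib Require Classical_Prop.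

(** View f as coefficients a(S) on subsets S of the variables and consider the
    s-fold mixed differences of a over s disjoint pairs of variables, at sets A
    with |A| + s = r.  Suppose all those of order s+1 vanish.  If many disjoint
    tuples have a nonzero difference of order s, choose blocks of such tuples.
    With high probability the random set splits every pair of some block;
    conditionally on this, swapping the pairs gives a product of s Boolean
    cubes, on which the s-fold differences of f are an integer kappa(i_1..i_s),
    nonzero on the diagonal, times binom(k-s, r-s), up to lower order in k.
    Induction on s, by Cauchy-Schwarz and a vector-valued Littlewood-Offord
    inequality, shows that f = l is unlikely.  Otherwise a bounded set Y meets
    every such tuple; fixing the most favourable pattern on Y leaves the degree
    r coefficients unchanged and makes the differences of order s vanish too.
    Once those of order 1 vanish, the degree r coefficients are all equal, so
    the degree r part is constant on the slice and one passes to degree r-1. *)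

Set Implicit Arguments.
Unset Strict Implicit.
Unset Printing Implicit Defensive.

Local Open Scope ring_scope.

Lemma big_powersetU1 (I : finType) (R : nmodType) (A : {set I}) (i : I)
    (G : {set I} -> R) :
  i \notin A ->
  \sum_(X in powerset (i |: A)) G X =
  \sum_(X in powerset A) (G X + G (i |: X)).
Proof.
move=> niA; rewrite (bigID (fun X : {set I} => i \in X)) /= addrC big_split /=.
congr (_ + _).
  apply: eq_bigl => X; rewrite !powersetE; apply/andP/idP.
    case=> sX niX; apply/subsetP => x xX.
    move: (subsetP sX x xX); rewrite !inE => /orP[/eqP xi|//].
    by rewrite -xi xX in niX.
  move=> sX; split; first exact: subset_trans sX (subsetUr _ _).
  by apply: contra niA => /(subsetP sX).
rewrite (reindex_onto (fun X => i |: X) (fun X => X :\ i)) /=; last first.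
  by move=> X /andP[_ iX]; rewrite setD1K.
apply: eq_bigl => X; rewrite !powersetE setU11 andbT; apply/andP/idP.
  case=> sX /eqP eX; apply/subsetP => x xX; have := xX.
  rewrite -eX !inE => /andP[/negPf nxi _].
  by move: (subsetP sX x); rewrite !inE nxi xX /= => ->.
move=> sX; split; first exact: setUS.
have niX : i \notin X by apply: contra niA => /(subsetP sX).
by rewrite setU1K.
Qed.

(** * Random walks that stay positive *)

Section WalkCount.
Local Open Scope nat_scope.

(* 2 ^ T times the probability that a simple random walk started at m
   stays positive for T steps. *)
Fixpoint walk (T m : nat) : nat :=
  if T is T'.+1 then (if m is m'.+1 then walk T' m'.+2 + walk T' m' else 0)
  else (0 < m).

Lemma walk0 T : walk T 0 = 0. Proof. by case: T. Qed.

Lemma walk_concave T m : walk T m.+2 + walk T m <= walk T m.+1 + walk T m.+1.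
Proof.
elim: T m => [|T IH] [|m] //=; last first.
  by have := IH m.+2; have := IH m; lia.
by have := IH 1; rewrite walk0; lia.
Qed.

Lemma walk_increments T a b :
  a <= b -> walk T b.+1 + walk T a <= walk T b + walk T a.+1.
Proof.
move/subnK => <-; elim: (b - a) => [|d IH]; first by rewrite addnC.
have := walk_concave T (d + a); rewrite addSn; lia.
Qed.

(** By concavity in the starting point, the sum over [m + j] and [m - j] is nonincreasing in j; for
    j = 1 it is the recursion defining [walk]. *)
Lemma walk_spread T m j : 0 < j <= m ->
  walk T (m + j) + walk T (m - j) <= walk T.+1 m.
Proof.
case: j => // j; elim: j => [|j IH] jm.
  by case: m jm => // m _; rewrite addn1 subn1.
apply: leq_trans (IH _); last by lia.
have -> : m - j.+1 = (m - j.+2).+1 by lia.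
by rewrite [m + j.+2]addnS; apply: walk_increments; lia.
Qed.

Lemma walk_le_exp T m : walk T m <= 2 ^ T.
Proof.
elim: T m => [|T IH] [|m] //=; rewrite expnS.
by have := IH m.+2; have := IH m; lia.
Qed.

(** Divided by [2 ^ T * T * L], the bound reads m / L + m (L - m) / T: the walk either reaches L
    before 0, or stays strictly between them for T steps, and the mean exit time is m (L - m). The
    induction uses that averaging m (L - m) over the two neighbours lowers it by 1. *)
Lemma walk_bound T L m : m <= L ->
  T * L * walk T m <= 2 ^ T * (L * (m * (L - m)) + T * m).
Proof.
elim: T m => [|T IH] m mL; first by rewrite !mul0n.
have [->|mltL] := eqVneq m L.
  rewrite subnn !muln0 add0n mulnC.
  by apply: leq_mul => //; exact: walk_le_exp.
case: m mL mltL => [|m] mL mltL; first by rewrite walk0 muln0.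
have IH1 := IH m.+2 ltac:(lia).
have IH0 := IH m ltac:(lia).
have := walk_le_exp T.+1 m.+1; rewrite /= expnS => W.
have [d dE] : exists d, L = m + d.+2 by exists (L - m.+2); lia.
subst L; have e2 : m + d.+2 - m.+2 = d by lia.
have e1 : m + d.+2 - m.+1 = d.+1 by lia.
have e0 : m + d.+2 - m = d.+2 by lia.
rewrite e2 in IH1; rewrite e0 in IH0; rewrite e1.
set w2 := walk T m.+2 in IH1 W *; set w0 := walk T m in IH0 W *.
set e := 2 ^ T in IH1 IH0 W *.
have W' : (m + d.+2) * (w2 + w0) <= (m + d.+2) * (2 * e) by rewrite leq_mul2l W orbT.
nia.
Qed.

End WalkCount.

(** * The Littlewood-Offord inequality in a torsion-free group *)

Section LittlewoodOfford.
Variables (I : finType) (E : zmodType) (kappa : I -> E).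
Hypothesis torsion_free : forall (x : E) n, x *+ n.+1 = 0 -> x = 0.

(** A translate contained in V would be a permutation of V; comparing the sums of the elements gives
    |V| e = 0. *)
Lemma shift_not_subset (V : seq E) (e : E) :
  uniq V -> V != [::] -> e != 0 ->
  has (fun v => v \notin V) [seq v - e | v <- V].
Proof.
move=> uV V0 e0; apply: contraT; rewrite -all_predC => /allP sV.
have uV' : uniq [seq v - e | v <- V].
  by rewrite map_inj_uniq // => x y /addIr.
have /(uniq_min_size uV') [|_ eV] : {subset [seq v - e | v <- V] <= V}.
  by move=> v /sV /=; rewrite negbK.
  by rewrite size_map.
have : \sum_(v <- [seq v - e | v <- V]) v = \sum_(v <- V) v.
  exact: perm_big (uniq_perm uV' uV eV).
rewrite big_map sumrB => /eqP; rewrite -subr_eq0 addrC addKr oppr_eq0.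
rewrite big_const_seq iter_addr_0 count_predT => /eqP.
case sV0: (size V) => [|n]; first by rewrite (size0nil sV0) in V0.
by move/torsion_free => e0'; rewrite e0' eqxx in e0.
Qed.

Definition hits (A : {set I}) (V : seq E) : nat :=
  (\sum_(X in powerset A) ((\sum_(i in X) kappa i)%R \in V))%N.

(* Conditioning on one coordinate i replaces V by its union and its intersection
   with V - kappa i; their sizes differ from that of V since E is torsion free,
   which yields the recurrence of the walk count. *)
Lemma hits_le (A J : {set I}) (V : seq E) :
  J \subset A -> {in J, forall i, kappa i != 0} -> uniq V ->
  (hits A V * 2 ^ #|J| <= 2 ^ #|A| * walk #|J| (size V))%N.
Proof.
have [n] := ubnP #|J|; elim: n => // n IH in A J V *.
rewrite ltnS => Jn sJ nzJ uV.
have [J0|[i iJ]] := set_0Vmem J.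
  rewrite J0 cards0 muln1 /=.
  case: V uV => [|v V] _ /=; first by rewrite /hits big1.
  rewrite muln1 -card_powerset -sum1_card; apply: leq_sum => X _.
  by case: (_ \in _).
have cJ : #|J| = #|J :\ i|.+1 by rewrite (cardsD1 i) iJ.
have iA := subsetP sJ i iJ.
set A' := A :\ i; set e := kappa i.
have niA' : i \notin A' by rewrite !inE eqxx.
have sJ' : J :\ i \subset A' by rewrite setSD.
have nzJ' : {in J :\ i, forall i, kappa i != 0}.
  by move=> j; rewrite inE => /andP[_]; exact: nzJ.
pose V' := [seq v - e | v <- V].
have uV' : uniq V' by rewrite map_inj_uniq // => x y /addIr.
pose U := V ++ [seq v <- V' | v \notin V].
pose N := [seq v <- V' | v \in V].
have hE : hits A V = (hits A' U + hits A' N)%N.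
  rewrite /hits -{1}(setD1K iA) -/A' big_powersetU1 // -big_split /=.
  apply: eq_bigr => X; rewrite powersetE => sX.
  have niX : i \notin X by apply: contra niA' => /(subsetP sX).
  rewrite big_setU1 //= -/e; set x := \sum_(_ in _) _.
  have -> : (e + x \in V) = (x \in V').
    apply/idP/mapP => [h|[v vV ->]]; last by rewrite addrC subrK.
    by exists (e + x); rewrite // addrC addKr.
  rewrite /U /N mem_cat !mem_filter.
  by case: (x \in V); case: (x \in V').
have uU : uniq U.
  rewrite cat_uniq uV filter_uniq // andbT /=; apply/hasPn => v.
  by rewrite mem_filter => /andP[].
have uN : uniq N by rewrite filter_uniq.
have hU := IH A' (J :\ i) U ltac:(rewrite -cJ; exact: Jn) sJ' nzJ' uU.
have hN := IH A' (J :\ i) N ltac:(rewrite -cJ; exact: Jn) sJ' nzJ' uN.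
have [V0|Vn0] := eqVneq V [::].
  by rewrite V0 /hits big1.
have := shift_not_subset uV Vn0 (nzJ _ iJ); rewrite -/e -/V' has_count => j0.
have sV' : size V' = size V by rewrite size_map.
have sN : size N = (size V - count (fun v => v \notin V) V')%N.
  rewrite size_filter -sV' -(count_predC (fun v => v \in V) V').
  exact: esym (addnK _ _).
have sU : size U = (size V + count (fun v => v \notin V) V')%N.
  by rewrite size_cat size_filter.
have W := @walk_spread #|J :\ i| (size V) _
  (introT andP (conj j0 (leq_trans (count_size _ _) (eq_leq sV')))).
rewrite -sU -sN -cJ in W.
have cA : #|A| = #|A'|.+1 by rewrite (cardsD1 i) iA.
rewrite hE cA {1}cJ !expnS.
have W' := leq_mul (leqnn (2 ^ #|A'|)) W.
rewrite mulnDr in W'.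
rewrite -mulnA.
have : (2 * (2 ^ #|A'| * walk #|J| (size V)) >=
  2 * (hits A' U * 2 ^ #|J :\ i| + hits A' N * 2 ^ #|J :\ i|))%N.
  rewrite leq_mul2l /=; apply: leq_trans W'; exact: leq_add.
by rewrite -mulnDl mulnCA.
Qed.

End LittlewoodOfford.

Lemma archi_nat (F : realType) (x : F) : exists n : nat, x <= n%:R.
Proof.
exists (Num.bound `|x|).
by apply: le_trans (ler_norm x) _; apply/ltW/archi_boundP.
Qed.

Lemma littlewood_offord (F : realType) (delta : F) : 0 < delta ->
  exists L, forall (I : finType) (E : zmodType) (kappa : I -> E)
    (J : {set I}) (v : E),
    (forall (x : E) n, x *+ n.+1 = 0 -> x = 0) ->
    (L <= #|J|)%N -> {in J, forall i, kappa i != 0} ->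
    #|[set X : {set I} | \sum_(i in X) kappa i == v]|%:R
      <= delta * #|{set I}|%:R.
Proof.
move=> d0; have [L LE] := archi_nat (2%:R / delta).
(* For T at least (L + 1)^2 both terms of [walk_bound] at m = 1 are at most 1 / (L + 1), so a walk
   from 1 survives with probability at most 2 / (L + 1) <= delta. *)
exists (L.+1 * L.+1)%N => I E kappa J v tf JL nz.
have := @hits_le _ _ kappa tf setT J [:: v] (subsetT J) nz erefl.
set T := #|J| in JL *; rewrite /hits cardsT.
have -> : (\sum_(X in powerset [set: I]) ((\sum_(i in X) kappa i)%R \in [:: v]))%N
  = #|[set X : {set I} | \sum_(i in X) kappa i == v]|.
  rewrite -sum1_card big_mkcond [RHS]big_mkcond /=; apply: eq_bigr => X _.
  by rewrite powersetE subsetT !inE; case: (_ == v).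
have -> : #|{set I}| = (2 ^ #|I|)%N.
  rewrite -(cardsT I) -card_powerset; apply: eq_card => X.
  by rewrite powersetE subsetT.
set c := #|[set X : {set I} | _]| => hc.
have := @walk_bound T L.+1 1 isT; rewrite subSS subn0 mul1n muln1 => hw.
have hw' : (L.+1 * walk T 1 <= 2 ^ T * 2)%N.
  rewrite -(@leq_pmul2l T); last by lia.
  rewrite mulnA; apply: leq_trans hw _.
  rewrite mulnCA leq_mul2l; apply/orP; right; nia.
have hc' : (L.+1 * c <= 2 ^ #|I| * 2)%N.
  rewrite -(@leq_pmul2r (2 ^ T)) ?expn_gt0 //.
  rewrite -mulnA; apply: leq_trans (leq_mul (leqnn L.+1) hc) _.
  by rewrite mulnCA -mulnA leq_mul2l [(2 * _)%N]mulnC hw' orbT.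
have : (L.+1%:R * c%:R : F) <= (2 ^ #|I|)%:R * 2%:R.
  by rewrite -!natrM ler_nat.
have L0 : 0 < (L.+1%:R : F) by rewrite ltr0n.
rewrite -ler_pdivlMl // => h; apply: le_trans h _.
rewrite [(2 ^ _)%:R * _]mulrC mulrA ler_wpM2r ?ler0n //.
rewrite mulrC ler_pdivrMr // mulrC -ler_pdivrMr //.
by apply: le_trans LE _; rewrite ler_nat.
Qed.

(** * Anticoncentration on a product of Boolean cubes *)

Lemma sqr_sum_le (F : realType) (Y : finType) (u : Y -> F) :
  (\sum_y u y) ^+ 2 <= #|Y|%:R * \sum_y u y ^+ 2.
Proof.
have [Y0|Y0] := posnP #|Y|.
  rewrite Y0 mul0r big_pred0 ?expr0n // => y.
  by have := fintype0 y Y0.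
set S := \sum_y u y; set Q := \sum_y _; set n := #|Y|%:R : F.
have n0 : 0 < n by rewrite ltr0n.
have : 0 <= \sum_y (n * u y - S) ^+ 2 by apply: sumr_ge0 => y _; exact: sqr_ge0.
have -> : \sum_y (n * u y - S) ^+ 2 = n * (n * Q - S ^+ 2).
  transitivity (\sum_y ((n ^+ 2 * u y ^+ 2 - (2 * n * S) * u y) + S ^+ 2)).
    by apply: eq_bigr => y _; ring.
  rewrite big_split sumrB -!mulr_sumr sumr_const -mulr_natl /= -/n -/S -/Q.
  by ring.
by rewrite pmulr_rge0 // subr_ge0.
Qed.

Lemma card_set_sum (F : realType) (T : finType) (P : pred T) :
  #|[set x | P x]|%:R = \sum_x (P x)%:R :> F.
Proof.
rewrite -natr_sum -sum1_card big_mkcond /=; congr (_%:R).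
by apply: eq_bigr => x _; rewrite inE; case: (P x).
Qed.

Lemma exists_subset_card (T : finType) (A : {set T}) n :
  (n <= #|A|)%N -> exists2 B : {set T}, B \subset A & #|B| = n.
Proof.
case/card_geqP => s [us <- sA]; exists [set x in s].
  by apply/subsetP => x; rewrite inE; exact: sA.
by rewrite cardsE; apply/card_uniqP.
Qed.

(** Take m disjoint pieces of size L out of J. On a piece J0 the vectors of the C i j, j in J0, are
    nonzero for i in J0 thanks to the diagonal, so the vector-valued inequality makes some
    coordinate in J0 differ from v. The union bound over the pieces costs m delta / (m + 1). *)
Lemma few_nonzero (F : realType) (delta : F) (m : nat) : 0 < delta ->
  exists M, forall (I : finType) (C : I -> I -> F) (J : {set I}) (v : I -> F),
    (M <= #|J|)%N -> {in J, forall i, C i i != 0} ->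
    #|[set X : {set I} |
        (#|[set j in J | (\sum_(i in X) C i j)%R != v j]| < m)%N]|%:R
      <= delta * #|{set I}|%:R.
Proof.
move=> d0; have d1 : 0 < delta / m.+1%:R by rewrite divr_gt0 ?ltr0n.
have [L LO] := littlewood_offord d1.
exists (m * L)%N => I C J v mL nz; set N := #|{set I}|%:R : F.
set P := fun (m : nat) (J : {set I}) => [set X : {set I} |
        (#|[set j in J | (\sum_(i in X) C i j)%R != v j]| < m)%N].
suff : #|P m J|%:R <= m%:R * (delta / m.+1%:R * N).
  move=> h; apply: le_trans h _; rewrite mulrA ler_wpM2r ?ler0n //.
  rewrite mulrCA ger_pMr // ler_pdivrMr ?ltr0n // mul1r ler_nat; lia.
elim: {1 2 3}m J mL nz => [|p IH] J pL nz.
  rewrite mul0r lern0 cards_eq0; apply/eqP/setP => X.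
  by rewrite !inE.
have [J0 sJ0 cJ0] : exists2 J0 : {set I}, J0 \subset J & #|J0| = L.
  by apply: exists_subset_card; lia.
pose col (i : I) : {ffun I -> F} := [ffun j => if j \in J0 then C i j else 0].
pose vJ : {ffun I -> F} := [ffun j => if j \in J0 then v j else 0].
have tf (x : {ffun I -> F}) n : x *+ n.+1 = 0 -> x = 0.
  move=> /ffunP h; apply/ffunP => j; move: (h j); rewrite ffunMnE !ffunE.
  by move/eqP; rewrite mulrn_eq0 => /eqP.
have nzc : {in J0, forall i, col i != 0}.
  move=> i iJ0; apply: contraNneq (nz i (subsetP sJ0 i iJ0)) => /ffunP/(_ i).
  by rewrite !ffunE iJ0 => ->.
have h1 := LO I _ col J0 vJ tf (eq_leq (esym cJ0)) nzc.
have h2 := IH (J :\: J0) ltac:(rewrite cardsDS // cJ0; lia)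
  ltac:(by move=> i; rewrite inE => /andP[_]; exact: nz).
have sub : P p.+1 J \subset
    [set X : {set I} | \sum_(i in X) col i == vJ] :|: P p (J :\: J0).
  apply/subsetP => X; rewrite !inE; apply: contraTT; rewrite negb_or -!leqNgt.
  case/andP => neq le.
  have /exists_inP[j jJ0 neqj] : [exists j in J0, \sum_(i in X) C i j != v j].
    apply: contraNT neq; rewrite negb_exists_in => /forall_inP all.
    apply/eqP/ffunP => j; rewrite sum_ffunE !ffunE.
    under eq_bigr do rewrite ffunE.
    case: ifP => jJ0; last by rewrite big1.
    by apply/eqP; have := all j jJ0; rewrite negbK.
  rewrite (cardsD1 j) !inE neqj (subsetP sJ0 j jJ0) add1n ltnS.
  apply: leq_trans le _; apply: subset_leq_card; apply/subsetP => i.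
  rewrite !inE => /andP[/andP[niJ0 ->] ->]; rewrite !andbT.
  by apply: contraNneq niJ0 => ->.
have : (#|P p.+1 J|%:R : F) <= (#|[set X : {set I} | \sum_(i in X) col i == vJ]|
      + #|P p (J :\: J0)|)%:R.
  by rewrite ler_nat; apply: leq_trans (subset_leq_card sub) (leq_card_setU _ _).
move=> h; apply: le_trans h _.
by rewrite natrD -natr1 mulrDl mul1r addrC; apply: lerD.
Qed.

Fixpoint cube (I : finType) (s : nat) : finType :=
  if s is s'.+1 then ({set I} * cube I s')%type else unit.

(* The s-fold mixed difference of g in the directions l = [:: i_1; ...; i_s],
   i_j in the j-th factor of the cube, is within nu of kap l everywhere. *)
Fixpoint approx (F : realType) (I : finType) (s : nat) (kap : seq I -> F)
    (g : cube I s -> F) (nu : F) : Prop :=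
  match s return (cube I s -> F) -> Prop with
  | 0 => fun g => `|g tt - kap [::]| <= nu
  | s'.+1 => fun g => forall (x : {set I}) (i : I), i \notin x ->
      approx (fun l => kap (i :: l)) (fun y : cube I s' => g (i |: x, y) - g (x, y)) nu
  end g.

Section Approx.
Variables (F : realType) (I : finType).
Implicit Types (kap : seq I -> F) (nu : F).

Lemma approx_ext s kap kap' (g g' : cube I s -> F) nu nu' :
  kap =1 kap' -> g =1 g' -> nu <= nu' -> approx kap g nu -> approx kap' g' nu'.
Proof.
elim: s kap kap' g g' => [|s IH] kap kap' g g' ek eg le /=.
  by rewrite ek eg => h; exact: le_trans h le.
move=> h x i ix; by apply: IH (h x i ix) => // y; rewrite ?eg ?ek.
Qed.

Lemma approxB s kap kap' (g g' : cube I s -> F) nu nu' :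
  approx kap g nu -> approx kap' g' nu' ->
  approx (fun l => kap l - kap' l) (fun y => g y - g' y) (nu + nu').
Proof.
elim: s kap kap' g g' => [|s IH] kap kap' g g' /=.
  move=> h h'; apply: le_trans (lerD h h').
  apply: le_trans (ler_normB _ _); rewrite le_eqVlt; apply/orP; left.
  by apply/eqP; congr `|_|; ring.
move=> h h' x i ix; apply: approx_ext (IH _ _ _ _ (h x i ix) (h' x i ix)) => //.
by move=> y; ring.
Qed.

Lemma approxD s kap kap' (g g' : cube I s -> F) nu nu' :
  approx kap g nu -> approx kap' g' nu' ->
  approx (fun l => kap l + kap' l) (fun y => g y + g' y) (nu + nu').
Proof.
elim: s kap kap' g g' => [|s IH] kap kap' g g' /=.
  move=> h h'; apply: le_trans (lerD h h').
  apply: le_trans (ler_normD _ _); rewrite le_eqVlt; apply/orP; left.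
  by apply/eqP; congr `|_|; ring.
move=> h h' x i ix; apply: approx_ext (IH _ _ _ _ (h x i ix) (h' x i ix)) => //.
by move=> y; ring.
Qed.

Lemma approx0 s : approx (fun _ : seq I => 0 : F) (fun _ : cube I s => 0) 0.
Proof.
elim: s => [|s IH] /=; first by rewrite subrr normr0.
by move=> x i _; apply: approx_ext IH => // y; rewrite subrr.
Qed.

(** Telescoping: x is built from the empty set one element at a time. The targets do not depend on
    the current set, so they add up to a sum linear in x, ready for [few_nonzero]. *)
Lemma approx_path s kap (g : cube I s.+1 -> F) nu (x : {set I}) :
  approx kap g nu ->
  approx (fun l => \sum_(i in x) kap (i :: l))
         (fun y : cube I s => g (x, y) - g (set0, y)) (#|x|%:R * nu).
Proof.
move=> h; have [n] := ubnP #|x|; elim: n x => // n IH x.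
have [-> _|[i ix]] := set_0Vmem x.
  rewrite cards0 mul0r; apply: approx_ext (approx0 s) => // [l|y].
    by rewrite big_set0.
  by rewrite subrr.
rewrite (cardsD1 i) ix add1n ltnS => lt.
have := h (x :\ i) i ltac:(by rewrite !inE eqxx).
rewrite setD1K // => h1.
apply: approx_ext (approxD h1 (IH (x :\ i) lt)) => // [l|y|].
- by rewrite [RHS](big_setD1 i).
- by ring.
- by rewrite -natr1 mulrDl mul1r addrC.
Qed.

End Approx.
(* In the step, Cauchy-Schwarz reduces g = 0 to g (x, y) = g (x', y) = 0 for
   independent x, x' in the first factor, and g (x, -) - g (x', -) has s-fold
   differences kh; by [few_nonzero] most pairs leave many nonzero diagonal
   entries of kh. *)
Lemma cube_anticonc (F : realType) (s : nat) (delta : F) : 0 < delta ->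
  exists M, forall (I : finType) (kap : seq I -> F) (g : cube I s -> F)
    (nu : F) (J : {set I}),
    (M <= #|J|)%N -> (forall l, kap l \is a Num.int) ->
    {in J, forall i, kap (nseq s i) != 0} ->
    0 <= nu -> approx kap g nu -> nu * (2 * #|I|)%:R ^+ s < 1 ->
    #|[set y | g y == 0]|%:R <= delta * #|cube I s|%:R.
Proof.
elim: s delta => [|s IH] delta d0.
  (* The cube is a single point, where g is within nu < 1 of a nonzero integer. *)
  exists 1%N => I kap g nu J; rewrite card_gt0 => /set0Pn[i iJ] ik nz _.
  move=> ap; rewrite expr0 mulr1 => nu1.
  suff -> : #|[set y | g y == 0]| = 0%N by rewrite mulr_ge0 ?ler0n ?ltW.
  apply: eq_card0 => -[]; rewrite inE; apply/negP => /eqP g0.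
  move: ap => /=; rewrite g0 sub0r normrN => ap.
  have := norm_intr_ge1 (ik [::]) (nz i iJ); lra.
(* One half of [delta ^+ 2] pays for the pairs in [few], the other for the induction hypothesis on
   the remaining pairs. *)
have dd : 0 < delta ^+ 2 / 2 by rewrite divr_gt0 // exprn_gt0.
have [M' AC] := IH _ dd; have [M FN] := few_nonzero M' dd.
exists M => I kap g nu J MJ ik nz nu0 ap nu1.
set N := #|{set I}|%:R : F; set T := #|cube I s|%:R : F.
have N0 : 0 <= N by exact: ler0n.
have T0 : 0 <= T by exact: ler0n.
have -> : #|cube I s.+1|%:R = N * T by rewrite -natrM -card_prod.
pose G (x : {set I}) (y : cube I s) : F := (g (x, y) == 0)%:R.
have -> : #|[set y | g y == 0]|%:R = \sum_y \sum_x G x y.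
  rewrite card_set_sum exchange_big pair_bigA /=.
  by apply: eq_bigr => -[x y] _.
pose few (x' : {set I}) := [set x : {set I} |
  (#|[set j in J | (\sum_(i in x) kap (i :: nseq s j))%R
       != (\sum_(i in x') kap (i :: nseq s j))%R]| < M')%N].
have both x x' : \sum_y G x y * G x' y <=
    (x \in few x')%:R * T + delta ^+ 2 / 2 * T.
  have [xf|xnf] := boolP (x \in few x').
    rewrite mul1r; apply: (@le_trans _ _ T); last by rewrite lerDl mulr_ge0 // ltW.
    rewrite /T -sum1_card natr_sum; apply: ler_sum => y _.
    by rewrite /G; case: eqP => _; case: eqP => _; rewrite ?mulr0 ?mul0r ?mulr1.
  rewrite mul0r add0r.
  pose h (y : cube I s) := g (x, y) - g (x', y).
  pose kh l := \sum_(i in x) kap (i :: l) - \sum_(i in x') kap (i :: l).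
  (* Both paths have at most |I| steps, so the error grows by the factor 2 |I|; the power in the
     hypothesis on nu provides for this. *)
  have aph : approx kh h ((2 * #|I|)%:R * nu).
    apply: approx_ext (approxB (approx_path x ap) (approx_path x' ap)) => //.
      by move=> y; rewrite /h; ring.
    rewrite -mulrDl ler_wpM2r // -natrD ler_nat mul2n -addnn.
    by apply: leq_add; exact: max_card.
  have := AC I kh h _ [set j in J | (\sum_(i in x) kap (i :: nseq s j))%R
       != (\sum_(i in x') kap (i :: nseq s j))%R] _ _ _ _ aph.
  move=> /(_ ltac:(by move: xnf; rewrite inE -leqNgt)).
  move=> /(_ ltac:(by move=> l; rewrite rpredB // rpred_sum)).
  move=> /(_ ltac:(by move=> j; rewrite inE subr_eq0 => /andP[])).
  move=> /(_ ltac:(by rewrite mulr_ge0)).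
  move=> /(_ ltac:(by rewrite mulrAC -exprS mulrC)).
  apply: le_trans; rewrite card_set_sum; apply: ler_sum => y _.
  rewrite /G /h; case: eqP => [->|_]; last by rewrite mul0r.
  by case: eqP => [->|_]; rewrite ?subrr ?eqxx ?mulr1 ?mulr0.
have pairs : \sum_x \sum_x' \sum_y G x y * G x' y <= delta ^+ 2 * (N * (N * T)).
  rewrite exchange_big /=.
  apply: (@le_trans _ _ (\sum_(x' : {set I}) delta ^+ 2 * (N * T))); last first.
    by rewrite sumr_const -mulr_natl -/N mulrCA.
  apply: ler_sum => x' _.
  apply: le_trans (ler_sum _ (fun x _ => both x x')) _.
  rewrite big_split /= -mulr_suml sumr_const -mulr_natl -/N.
  have := FN I (fun i j => kap (i :: nseq s j)) J
    (fun j => \sum_(i in x') kap (i :: nseq s j)) MJ nz.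
  rewrite -/(few x') -/N => h.
  rewrite -(@card_set_sum F _ (fun x => x \in few x')) cardsE.
  have := ler_wpM2r T0 h; lra.
have cs := sqr_sum_le (fun y => \sum_x G x y).
have eqs : \sum_y (\sum_x G x y) ^+ 2 = \sum_x \sum_x' \sum_y G x y * G x' y.
  under eq_bigr => y _.
    rewrite expr2 mulr_suml; under eq_bigr do rewrite mulr_sumr; over.
  rewrite exchange_big; apply: eq_bigr => x _; exact: exchange_big.
have NT0 : 0 <= delta * (N * T) by rewrite !mulr_ge0 // ltW.
have S0 : 0 <= \sum_y \sum_x G x y.
  by apply: sumr_ge0 => y _; apply: sumr_ge0 => x _; exact: ler0n.
rewrite -(@ler_pXn2r _ 2) ?nnegrE //.
apply: le_trans cs _; rewrite eqs -/T.
apply: le_trans (ler_wpM2l _ pairs) _; first by rewrite ler0n.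
suff -> : T * (delta ^+ 2 * (N * (N * T))) = (delta * (N * T)) ^+ 2 by [].
by ring.
Qed.

(** * Slices of a finite set and conditioning on blocks *)

Section SliceSets.
Variable V : finType.

Definition slc (W : {set V}) (k : nat) : {set {set V}} :=
  [set X : {set V} | X \subset W & #|X| == k].

Lemma card_slc W k : #|slc W k| = 'C(#|W|, k).
Proof. exact: cards_draws. Qed.

Lemma sum_slc_split (R : nmodType) (U W : {set V}) (k : nat) (G : {set V} -> R) :
  U \subset W ->
  \sum_(X in slc W k) G X =
  \sum_(P in powerset U | (#|P| <= k)%N)
     \sum_(X in slc (W :\: U) (k - #|P|)) G (P :|: X).
Proof.
move=> sUW.
rewrite (partition_big (fun X : {set V} => X :&: U)
  (fun P => (P \in powerset U) && (#|P| <= k)%N)) /=; last first.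
  move=> X; rewrite inE powersetE subsetIr => /andP[_ /eqP <-].
  by rewrite subset_leq_card ?subsetIl.
apply: eq_bigr => P; rewrite powersetE => /andP[sPU Pk].
rewrite (reindex_onto (fun X => P :|: X) (fun X => X :\: U)) /=; last first.
  by move=> X /andP[_ /eqP <-]; rewrite setID.
apply: eq_bigl => X; rewrite !inE; apply/idP/idP.
  case/andP=> /andP[/andP[sW cX] _] /eqP eX.
  have sX : X \subset W :\: U by rewrite -eX setSD.
  have dPX : P :&: X = set0.
    apply/eqP; rewrite setI_eq0; apply: disjointWl sPU _.
    by rewrite disjoint_sym; move: sX; rewrite subsetD => /andP[].
  by rewrite sX; move: cX; rewrite cardsU dPX cards0 subn0 => /eqP <-; rewrite addKn eqxx.
case/andP=> sX /eqP cX; move: (sX); rewrite subsetD => /andP[sXW dXU].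
have dPX : P :&: X = set0.
  by apply/eqP; rewrite setI_eq0; apply: disjointWl sPU _; rewrite disjoint_sym.
rewrite subUset sXW (subset_trans sPU sUW) cardsU dPX cards0 subn0 cX.
rewrite subnKC // eqxx /= setIUl setDUl.
rewrite (setIidPl sPU) (disjoint_setI0 dXU) setU0 eqxx /=.
have -> : P :\: U = set0 by apply/eqP; rewrite setD_eq0.
by rewrite set0U; apply/eqP/setDidPl.
Qed.

End SliceSets.

(** Each coordinate forced to 0 or 1 divides the count by n / (n - k) or n / k; the hypotheses
    compare the initial n with the final numbers of ones and zeros, so these ratios stay at most R
    throughout. *)
Lemma bin_shrink (R a b n k : nat) :
  (a <= k -> k + b <= n -> n <= R * (k - a) -> n <= R * (n - k - b) ->
  'C(n, k) <= R ^ (a + b) * 'C(n - a - b, k - a))%N.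
Proof.
elim: a n k => [|a IHa] n k.
  move=> _; elim: b n => [|b IHb] n.
    by move=> _ _ _; rewrite mul1n !subn0.
  case: n => [|n]; first lia.
  move=> kb nk nb; have := IHb n ltac:(lia) ltac:(nia)
    ltac:(by move: nb; rewrite subSn ?subSS; [exact: ltnW|lia]).
  rewrite !add0n !subn0 subSS expnS -mulnA => h.
  apply: (@leq_trans (R * 'C(n, k))); last by rewrite leq_mul2l h orbT.
  have kn : (0 < n.+1 - k)%N by lia.
  have e := mul_bin_down n.+1 k; rewrite /= in e.
  rewrite -(leq_pmul2l kn) -e mulnA leq_mul2r; apply/orP; right.
  rewrite mulnC; apply: leq_trans nb _; rewrite leq_mul2l; apply/orP; right; lia.
case: n k => [|n] [|k]; try lia.
move=> ak kb nk nb; have := IHa n k ltac:(lia) ltac:(lia) ltac:(lia) ltac:(nia).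
rewrite !subSS addSn expnS -mulnA => h.
apply: (@leq_trans (R * 'C(n, k))); last by rewrite leq_mul2l h orbT.
have e := mul_bin_diag n.+1 k; rewrite /= in e.
rewrite -(leq_pmul2l (ltn0Sn k)) -e mulnA leq_mul2r; apply/orP; right.
rewrite mulnC; apply: leq_trans nk _; rewrite leq_mul2l; apply/orP; right; lia.
Qed.

(* Condition on the trace of X on U 0.  Given that it is one of the sets
   [pts 0 y], the choice of y is uniform and [phi] has probability at most
   delta; this happens with probability at least R ^- (2 a), and otherwise
   one continues with the next block on the remaining slice. *)
Lemma blocks_anticonc (F : realType) (V T : finType) (R a : nat) (delta : F)
    (m : nat) (W : {set V}) (k : nat) (pts : nat -> T -> {set V})
    (U : nat -> {set V}) (phi : pred {set V}) :
  (0 < R)%N -> (0 < #|T|)%N -> 0 <= delta ->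
  (forall i y, (i < m)%N -> pts i y \subset U i /\ #|pts i y| = a) ->
  (forall i, (i < m)%N -> injective (pts i)) ->
  (forall i, (i < m)%N -> U i \subset W /\ #|U i| = (a + a)%N) ->
  (forall i j, (i < j < m)%N -> [disjoint U i & U j]) ->
  (m * (a + a) <= k)%N -> (k + m * (a + a) <= #|W|)%N ->
  (#|W| <= R * (k - m * (a + a)))%N ->
  (#|W| <= R * (#|W| - k - m * (a + a)))%N ->
  (forall i (Z : {set V}), (i < m)%N -> Z \subset W :\: U i -> #|Z| = (k - a)%N ->
     \sum_(y : T) (phi (pts i y :|: Z))%:R <= delta * #|T|%:R) ->
  \sum_(X in slc W k) (phi X)%:R
    <= (delta + (1 - (R ^ (a + a))%:R^-1) ^+ m) * #|slc W k|%:R.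
Proof.
move=> R0 T0 d0; set beta := 1 - _.
elim: m W k pts U phi => [|m IH] W k pts U phi hpts hinj hU hdis mk kW WR WR' hphi.
  rewrite expr0 -sum1_card natr_sum mulr_sumr; apply: ler_sum => X _.
  by case: (phi X); rewrite ?mulr1 ?lerDr ?addr_ge0.
have [sUW cU] := hU 0 isT.
have cWU : #|W :\: U 0| = (#|W| - (a + a))%N by rewrite cardsDS // cU.
have Rp0 : 0 < (R ^ (a + a))%:R :> F by rewrite ltr0n expn_gt0 R0.
have beta0 : 0 <= beta.
  by rewrite subr_ge0 invf_le1 // ler1n expn_gt0 R0.
pose act := [set pts 0 y | y : T].
pose NP (P : {set V}) : F := #|slc (W :\: U 0) (k - #|P|)|%:R.
have NP0 P : 0 <= NP P by exact: ler0n.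
have cardW : #|slc W k|%:R = \sum_(P in powerset (U 0) | (#|P| <= k)%N) NP P.
  rewrite -sum1_card natr_sum (sum_slc_split _ _ sUW); apply: eq_bigr => P _.
  by rewrite /NP -[X in _ = X%:R]sum1_card natr_sum.
have inact P : P \in act -> (P \in powerset (U 0)) && (#|P| <= k)%N.
  case/imsetP => y _ ->; have [s c] := hpts 0 y isT.
  by rewrite powersetE s c /=; lia.
have sum_act (G : {set V} -> F) :
    \sum_(P in powerset (U 0) | (#|P| <= k)%N) G P =
    \sum_(P in act) G P +
    \sum_(P in powerset (U 0) | (#|P| <= k)%N && (P \notin act)) G P.
  rewrite (bigID (fun P => P \in act)) /=; congr (_ + _); apply: eq_bigl => P.
    by apply/idP/idP => [/andP[]//|Pa]; rewrite Pa inact.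
  by rewrite andbA.
(* All active traces have a elements, so they share one remaining slice; exchanging the sums leaves
   an average over y for each X in it. *)
have active : \sum_(P in act) \sum_(X in slc (W :\: U 0) (k - #|P|)) (phi (P :|: X))%:R
    <= delta * \sum_(P in act) NP P.
  rewrite !big_imset /=; try by move=> x y _ _; exact: hinj.
  have -> : \sum_y NP (pts 0 y) = #|T|%:R * #|slc (W :\: U 0) (k - a)|%:R.
    rewrite -[X in X%:R * _]cardsT -sum1_card natr_sum mulr_suml.
    apply: eq_big => [y|y _]; first by rewrite inE.
    by rewrite mul1r /NP (hpts 0 y isT).2.
  under eq_bigr => y _ do rewrite (hpts 0 y isT).2.
  rewrite exchange_big mulrA -[X in _ * X%:R]sum1_card natr_sum mulr_sumr.
  apply: ler_sum => X; rewrite inE mulr1 => /andP[sX /eqP cX].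
  exact: hphi.
(* Here P may have any size up to 2 a; the size hypotheses reserve 2 a ones and 2 a zeros per block
   for this. *)
have inactive : \sum_(P in powerset (U 0) | (#|P| <= k)%N && (P \notin act))
      \sum_(X in slc (W :\: U 0) (k - #|P|)) (phi (P :|: X))%:R
    <= (delta + beta ^+ m) *
       \sum_(P in powerset (U 0) | (#|P| <= k)%N && (P \notin act)) NP P.
  rewrite mulr_sumr; apply: ler_sum => P; rewrite powersetE => /and3P[sP Pk _].
  have cP : (#|P| <= a + a)%N by rewrite -cU subset_leq_card.
  apply: (IH _ _ (fun i => pts i.+1) (fun i => U i.+1)
    (fun X => phi (P :|: X))).
  - by move=> i y im; apply: hpts.
  - by move=> i im; apply: hinj.
  - move=> i im; have [s c] := hU i.+1 im; split => //.
    by rewrite subsetD s disjoint_sym hdis.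
  - by move=> i j ij; apply: hdis.
  - lia.
  - rewrite cWU; lia.
  - rewrite cWU; apply: leq_trans (leq_subr _ _) (leq_trans WR _).
    by rewrite leq_mul2l; apply/orP; right; lia.
  - rewrite cWU; apply: leq_trans (leq_subr _ _) (leq_trans WR' _).
    by rewrite leq_mul2l; apply/orP; right; lia.
  move=> i Z im; rewrite subsetD subsetD => /andP[/andP[sZW dZU] dZU'] cZ.
  have dPZ : [disjoint P & Z].
    by apply: disjointWl sP _; rewrite disjoint_sym.
  have sPW := subset_trans sP sUW.
  under eq_bigr => y _ do rewrite setUCA.
  apply: hphi => //.
    rewrite subsetD subUset sPW sZW -setI_eq0 setIUl setU_eq0 !setI_eq0 dZU' !andbT /=.
    by apply: disjointWl sP _; apply: hdis.
  by rewrite cardsU (disjoint_setI0 dPZ) cards0 subn0 cZ; nia.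
(* A single active trace already carries a share R^-(2 a) of the slice. *)
have dens : NP (pts 0 (enum_val (Ordinal T0))) * (R ^ (a + a))%:R >= #|slc W k|%:R.
  rewrite /NP (hpts 0 _ isT).2 -natrM ler_nat !card_slc cWU mulnC.
  by rewrite subnDA; apply: bin_shrink; nia.
have dens' : #|slc W k|%:R * (R ^ (a + a))%:R^-1 <= \sum_(P in act) NP P.
  rewrite ler_pdivrMr //; apply: le_trans dens _; rewrite ler_pM2r //.
  rewrite (bigD1 (pts 0 (enum_val (Ordinal T0)))) /=; last exact: imset_f.
  by rewrite lerDl sumr_ge0.
rewrite (sum_slc_split _ _ sUW) sum_act; apply: le_trans (lerD active inactive) _.
move: cardW; rewrite sum_act; set A := \sum_(P in act) _ in dens' *.
set B := \sum_(P in _ | _) _ => cardW.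
rewrite mulrDl mulrDl addrA -mulrDr -cardW lerD2l exprSr -mulrA.
rewrite ler_wpM2l ?exprn_ge0 // /beta mulrBl mul1r.
by move: dens'; rewrite mulrC; rewrite cardW; lra.
Qed.

(** The ratio of the binomials at t and t - 1 is (m - t + 1) / t, and they increase up to the
    middle. *)
Lemma bin_lower_le (m t j : nat) : (t + t <= m -> j < t ->
  (m - t) * 'C(m, j) <= t * 'C(m, t))%N.
Proof.
move=> tm; elim: t tm => // t IH tm; rewrite ltnS leq_eqVlt => /orP[/eqP ->|jt].
  by rewrite mul_bin_left leq_mul2r; apply/orP; right; lia.
have h := IH ltac:(lia) jt.
have e := mul_bin_left m t.
have inc : ('C(m, t) <= 'C(m, t.+1))%N.
  rewrite -(leq_pmul2l (ltn0Sn t)) e leq_mul2r; apply/orP; right; lia.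
apply: leq_trans (leq_mul (leqnSn t) inc).
by apply: leq_trans h; rewrite leq_mul2r; apply/orP; right; lia.
Qed.

(** The lower levels together are smaller than level t by a factor of order t^2 / m; this makes the
    lower-order terms of the differences negligible for large k. *)
Lemma bin_lower_sum (m t : nat) : (t + t <= m ->
  (m - t) * \sum_(j < t) 'C(m, j) <= t * t * 'C(m, t))%N.
Proof.
move=> tm; have -> : (t * t * 'C(m, t) = \sum_(j < t) t * 'C(m, t))%N.
  by rewrite sum_nat_const card_ord mulnA.
rewrite big_distrr /=.
by apply: leq_sum => j _; exact: bin_lower_le.
Qed.

(** * Mixed differences of a coefficient function *)

Section MixedDifferences.
Variables (F : realType) (V : finType).
Implicit Types (phi psi a : {set V} -> F) (p : V * V) (qs : seq (V * V)).

Definition pdiff p phi (A : {set V}) : F := phi (p.1 |: A) - phi (p.2 |: A).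

(** With [foldl] the last pair is the outermost difference, hence the inductions on lists from the
    right. *)
Definition mdiff qs phi : {set V} -> F :=
  foldl (fun phi p => pdiff p phi) phi qs.

(** The value at the indicator vector of X of the multilinear polynomial with coefficients [a]. *)
Definition ev a (X : {set V}) : F := \sum_(S in powerset X) a S.

Definition verts qs : seq V := flatten [seq [:: p.1; p.2] | p <- qs].

Definition good (W : {set V}) qs (A : {set V}) : bool :=
  [&& uniq (verts qs), all (mem W) (verts qs), A \subset W &
      all (fun x => x \notin A) (verts qs)].

Lemma mdiff_rcons qs p phi : mdiff (rcons qs p) phi = pdiff p (mdiff qs phi).
Proof. exact: foldl_rcons. Qed.

Lemma verts_rcons qs p : verts (rcons qs p) = verts qs ++ [:: p.1; p.2].
Proof. by rewrite /verts map_rcons flatten_rcons. Qed.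

Lemma good_rcons W qs p A : good W (rcons qs p) A =
  [&& good W qs A, p.1 != p.2, p.1 \in W :\: A, p.2 \in W :\: A,
      p.1 \notin verts qs & p.2 \notin verts qs].
Proof.
rewrite /good verts_rcons cat_uniq !all_cat /= !inE !negb_or !andbT.
case: (uniq _) => //=; case: (all (mem W) _); rewrite /= ?andbF //.
case: (A \subset W); rewrite /= ?andbF //.
case: (all _ _); rewrite /= ?andbF //.
by case: (p.1 == p.2); case: (p.1 \in W); case: (p.2 \in W);
   case: (p.1 \in A); case: (p.2 \in A); case: (p.1 \in verts qs);
   case: (p.2 \in verts qs).
Qed.

Lemma goodU1 W qs x A :
  good W qs A -> x \in W -> x \notin verts qs -> good W qs (x |: A).
Proof.
case/and4P=> u sW sA nA xW nx; rewrite /good u sW subUset sub1set xW sA /=.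
apply/allP => y yq; rewrite !inE negb_or (allP nA y yq) andbT.
by apply: contraNneq nx => <-.
Qed.

Lemma good_sub W qs (A B : {set V}) : good W qs B -> A \subset B -> good W qs A.
Proof.
case/and4P=> u sW sB nB sAB; rewrite /good u sW (subset_trans sAB sB) /=.
by apply/allP => y yq; apply: contra (allP nB y yq) => /(subsetP sAB).
Qed.

(** Only sets made of A and one vertex of each pair are evaluated, all of the same size. *)
Lemma mdiff_congr (W : {set V}) n phi psi qs A :
  (forall S : {set V}, S \subset W -> #|S| = n -> phi S = psi S) ->
  good W qs A -> (#|A| + size qs = n)%N -> mdiff qs phi A = mdiff qs psi A.
Proof.
move=> e; elim/last_ind: qs A => [|qs p IH] A.
  by case/and4P=> _ _ sA _ /=; rewrite addn0 => cA; exact: e.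
rewrite good_rcons size_rcons !mdiff_rcons /pdiff.
case/and5P=> gA np /setDP[p1W p1A] /setDP[p2W p2A] /andP[n1 n2] cA.
by rewrite !IH ?goodU1 ?cardsU1 ?p1A ?p2A //; lia.
Qed.

Lemma mdiff_eq0 (W : {set V}) phi qs (A : {set V}) :
  (forall S : {set V}, S \subset W -> #|S| = (#|A| + size qs)%N -> phi S = 0) ->
  good W qs A -> mdiff qs phi A = 0.
Proof.
move=> h gA; rewrite (@mdiff_congr W _ phi (fun=> 0) qs A h gA erefl).
elim/last_ind: qs A {h gA} => [//|qs p IH] A.
by rewrite mdiff_rcons /pdiff !IH subrr.
Qed.

Lemma mdiff_int qs phi A :
  (forall S, phi S \is a Num.int) -> mdiff qs phi A \is a Num.int.
Proof.
move=> h; elim/last_ind: qs A => [|qs p IH] A; first exact: h.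
by rewrite mdiff_rcons /pdiff rpredB.
Qed.

Lemma mdiff_bound qs phi A q :
  (forall S, `|phi S| <= q) -> `|mdiff qs phi A| <= 2 ^+ size qs * q.
Proof.
move=> h; elim/last_ind: qs A => [|qs p IH] A; first by rewrite mul1r; exact: h.
rewrite mdiff_rcons /pdiff size_rcons exprS -mulrA mulr_natl mulr2n.
by apply: le_trans (ler_normB _ _) _; apply: lerD.
Qed.

(** Subsets of Z cancel; what remains matches [p.1 |: A] with [p.2 |: A] for A inside Z. *)
Lemma mdiff_ev W qs a Z :
  good W qs Z -> mdiff qs (ev a) Z = ev (mdiff qs a) Z.
Proof.
elim/last_ind: qs Z => [//|qs p IH] Z; rewrite good_rcons !mdiff_rcons {1}/pdiff.
case/and5P=> gZ np /setDP[p1W p1Z] /setDP[p2W p2Z] /andP[n1 n2].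
rewrite !IH ?goodU1 // /ev !big_powersetU1 // -sumrB.
by apply: eq_bigr => A _; rewrite /pdiff; ring.
Qed.

Definition vanish (r s : nat) (W : {set V}) a : Prop :=
  forall qs (A : {set V}), size qs = s -> good W qs A -> (#|A| + s = r)%N -> mdiff qs a A = 0.

(** Exchange x in A \ B for y in B \ A: the two values differ by the mixed difference with (x, y)
    appended, at A minus x, which vanishes. Induction on |A \ B|. *)
Lemma mdiff_const r W a qs (A B : {set V}) :
  vanish r (size qs).+1 W a -> good W qs A -> good W qs B ->
  #|A| = #|B| -> (#|A| + size qs = r)%N -> mdiff qs a A = mdiff qs a B.
Proof.
move=> van; have [n] := ubnP #|A :\: B|; elim: n => // n IH in A *.
rewrite ltnS => lt gA gB cAB cA.
have cDD : #|A :\: B| = #|B :\: A|.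
  have := cardsID B A; have := cardsID A B; rewrite setIC cAB; lia.
have [D0|[x xAB]] := set_0Vmem (A :\: B).
  suff -> : A = B by [].
  by apply/eqP; rewrite eqEcard cAB leqnn andbT -setD_eq0 D0.
have [y yBA] : exists y, y \in B :\: A.
  by apply/set0Pn; rewrite -card_gt0 -cDD card_gt0; apply/set0Pn; exists x.
have /setDP[xA xB] := xAB; have /setDP[yB yA] := yBA.
have [/and4P[u sV sAW nA] /and4P[_ _ sBW nB]] := (gA, gB).
have xq : x \notin verts qs by apply/negP => /(allP nA); rewrite xA.
have yq : y \notin verts qs by apply/negP => /(allP nB); rewrite yB.
have gA1 : good W qs (A :\ x) by apply: good_sub gA (subD1set _ _).
have gA1' : good W (rcons qs (x, y)) (A :\ x).
  rewrite good_rcons gA1 /= xq yq !inE eqxx (negPf yA) andbF /=.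
  rewrite (subsetP sAW _ xA) (subsetP sBW _ yB) !andbT.
  by apply: contraNneq xB => ->.
have cA1 : #|A| = #|A :\ x|.+1 by rewrite (cardsD1 x A) xA.
have cr : (#|A :\ x| + (size qs).+1 = r)%N by rewrite addnS -addSn -cA1.
have := van _ _ (size_rcons _ _) gA1' cr.
rewrite mdiff_rcons /pdiff /= setD1K // => /eqP; rewrite subr_eq0 => /eqP ->.
apply: IH => //.
- apply: leq_trans lt; rewrite (cardsD1 x (A :\: B)) xAB add1n ltnS.
  apply: subset_leq_card; apply/subsetP => z; rewrite !inE.
  by case: (z =P y) => [->|_]; rewrite ?yB //= => /andP[-> /andP[-> ->]].
- by apply: goodU1 => //; exact: (subsetP sBW).
- by rewrite cardsU1 !inE (negPf yA) andbF /= -cAB cA1.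
- by rewrite cardsU1 !inE (negPf yA) andbF /= add1n -cA1.
Qed.

(** The common value provided by [mdiff_const], read at any admissible A; the default 0 keeps it an
    integer. *)
Definition kappaV (r : nat) (W : {set V}) a qs : F :=
  if [pick A : {set V} | good W qs A && (#|A| + size qs == r)%N] is Some A
  then mdiff qs a A else 0.

Lemma kappaVE r W a qs (A : {set V}) : vanish r (size qs).+1 W a ->
  good W qs A -> (#|A| + size qs = r)%N -> kappaV r W a qs = mdiff qs a A.
Proof.
move=> van gA cA; rewrite /kappaV; case: pickP => [B /andP[gB /eqP cB]|/(_ A)].
  exact: mdiff_const van gB gA (addIn (etrans cB (esym cA))) cB.
by rewrite gA cA eqxx.
Qed.

Lemma kappaV_int r W a qs :
  (forall S, a S \is a Num.int) -> kappaV r W a qs \is a Num.int.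
Proof. by move=> h; rewrite /kappaV; case: pickP => // A _; exact: mdiff_int. Qed.

(** Expand over A inside Z by [mdiff_ev], with s the size of qs. Above level r - s the degree bound
    gives 0, level r - s contributes [kappaV] once per set, and below it each set contributes at
    most 2^s q. *)
Lemma mdiff_ev_approx r W a qs (Z : {set V}) q :
  (forall S, `|a S| <= q) -> (forall S : {set V}, (r < #|S|)%N -> a S = 0) ->
  vanish r (size qs).+1 W a -> good W qs Z -> (size qs <= r)%N ->
  `|mdiff qs (ev a) Z - kappaV r W a qs * 'C(#|Z|, r - size qs)%:R| <=
    2 ^+ size qs * q * (\sum_(j < r - size qs) 'C(#|Z|, j))%:R.
Proof.
move=> aq deg van gZ sr; set t := (r - size qs)%N; set c := 2 ^+ _ * q.
have levels j : 'C(#|Z|, j)%:R = \sum_(A in powerset Z) (#|A| == j)%:R :> F.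
  rewrite -cards_draws -natr_sum -sum1_card big_mkcond [in RHS]big_mkcond /=.
  congr (_%:R); apply: eq_bigr => A _; rewrite inE powersetE.
  by case: (A \subset Z); case: (#|A| == j).
rewrite (mdiff_ev _ gZ) /ev levels mulr_sumr -sumrB natr_sum.
under [X in c * X]eq_bigr => j _ do rewrite levels.
rewrite exchange_big mulr_sumr /=; apply: le_trans (ler_norm_sum _ _ _) _.
have c0 : 0 <= c by apply: le_trans (mdiff_bound qs set0 aq).
apply: ler_sum => A; rewrite powersetE => sA.
have gA := good_sub gZ sA.
have [At|At|At] := ltngtP #|A| t.
- rewrite mulr0 subr0 (bigD1 (Ordinal At)) //= eqxx mulrDr mulr1.
  apply: le_trans (mdiff_bound qs A aq) _; rewrite lerDl mulr_ge0 //.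
  by apply: sumr_ge0.
- rewrite mulr0 subr0 (@mdiff_eq0 W) // ?normr0; last first.
    by move=> S _ cS; apply: deg; rewrite cS; lia.
  by apply: mulr_ge0 c0 _; exact: sumr_ge0.
- rewrite mulr1 (kappaVE van gA) ?subrr ?normr0; last by rewrite At subnK.
  by apply: mulr_ge0 c0 _; exact: sumr_ge0.
Qed.

End MixedDifferences.

(** * Embedding a product of cubes in the slice *)

Section Grid.
Variables (V I : finType).

(** [v j i b] is endpoint b of the j-th pair of the i-th tuple. A point y takes one endpoint of each
    pair: [true] when i belongs to the j-th factor of y, [false] otherwise. *)
Fixpoint pts (s : nat) (v : nat -> I -> bool -> V) : cube I s -> {set V} :=
  match s return cube I s -> {set V} with
  | 0 => fun=> set0
  | s'.+1 => fun y =>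
      [set v 0 i (i \in y.1) | i : I] :|: @pts s' (fun j => v j.+1) y.2
  end.

Fixpoint grid (s : nat) (v : nat -> I -> bool -> V) : {set V} :=
  if s is s'.+1 then
    [set v 0 p.1 p.2 | p : I * bool] :|: grid s' (fun j => v j.+1)
  else set0.

(** The j-th pair is taken from the tuple named by the j-th entry of l: a constant list gives back
    one of the given tuples, other lists mix several. *)
Fixpoint mkpairs (v : nat -> I -> bool -> V) (l : seq I) : seq (V * V) :=
  if l is i :: l' then
    (v 0 i true, v 0 i false) :: mkpairs (fun j => v j.+1) l'
  else [::].

Definition grid_inj (s : nat) (v : nat -> I -> bool -> V) : Prop :=
  forall j j' i i' b b', (j < s)%N -> (j' < s)%N ->
    v j i b = v j' i' b' -> [/\ j = j', i = i' & b = b'].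

Lemma grid_injS s v : grid_inj s.+1 v -> grid_inj s (fun j => v j.+1).
Proof.
by move=> h j j' i i' b b' js j's /h[]// [->] -> ->.
Qed.

Lemma gridP s v x :
  reflect (exists j i b, (j < s)%N /\ x = v j i b) (x \in grid s v).
Proof.
elim: s v x => [|s IH] v x /=; first by rewrite inE; apply: ReflectF => -[j [i [b []]]].
rewrite inE; apply: (iffP orP) => [[/imsetP[[i b] _ ->]|/IH[j [i [b [js ->]]]]]|].
- by exists 0, i, b.
- by exists j.+1, i, b.
case=> -[|j] [i [b [js ->]]]; [left|right; apply/IH; by exists j, i, b].
by apply/imsetP; exists (i, b).
Qed.

Lemma grid_disjoint s v : grid_inj s.+1 v ->
  [disjoint [set v 0 p.1 p.2 | p : I * bool] & grid s (fun j => v j.+1)].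
Proof.
move=> vi; rewrite disjoint_subset; apply/subsetP => x /imsetP[[i b] _ ->].
by rewrite inE; apply/negP => /gridP[j [i' [b' [js /vi[]]]]].
Qed.

Lemma card_grid s v : grid_inj s v -> #|grid s v| = (s * #|I| + s * #|I|)%N.
Proof.
elim: s v => [|s IH] v vi /=; first by rewrite cards0.
rewrite cardsU (disjoint_setI0 (grid_disjoint vi)) cards0 subn0 (IH _ (grid_injS vi)).
rewrite card_imset; first by rewrite card_prod card_bool mulSn muln2 -addnn addnACA.
by move=> [i b] [i' b'] /= /vi[] // _ -> ->.
Qed.

Lemma pts_sub s v y : @pts s v y \subset grid s v.
Proof.
elim: s v y => [|s IH] v y /=; first exact: sub0set.
apply: setUSS (IH _ _); apply/subsetP => x /imsetP[i _ ->].
by apply/imsetP; exists (i, i \in y.1).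
Qed.

Lemma pts_head_sub (v : nat -> I -> bool -> V) (x : {set I}) :
  [set v 0 i (i \in x) | i : I] \subset [set v 0 p.1 p.2 | p : I * bool].
Proof. by apply/subsetP => z /imsetP[i _ ->]; apply/imsetP; exists (i, i \in x). Qed.

Lemma card_pts s v y : grid_inj s v -> #|@pts s v y| = (s * #|I|)%N.
Proof.
elim: s v y => [|s IH] v y vi /=; first by rewrite cards0.
have d : [disjoint [set v 0 i (i \in y.1) | i : I] & pts (fun j => v j.+1) y.2].
  apply: disjointW (grid_disjoint vi); [exact: pts_head_sub|exact: pts_sub].
rewrite cardsU (disjoint_setI0 d) cards0 subn0 (IH _ _ (grid_injS vi)) mulSn.
by rewrite card_imset // => i i' /vi[].
Qed.

Lemma pts_inj s v : grid_inj s v -> injective (@pts s v).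
Proof.
elim: s v => [|s IH] v vi; first by case=> -[].
move=> y y' e.
have head : [set v 0 i (i \in y.1) | i : I] = [set v 0 i (i \in y'.1) | i : I].
  apply/setP => z; have := congr1 (fun X : {set V} => z \in X) e; rewrite /= !inE.
  case zG: (z \in [set v 0 p.1 p.2 | p : I * bool]).
    have nz y0 : (z \in @pts s (fun j => v j.+1) y0) = false.
      apply/negbTE; apply/negP => /(subsetP (pts_sub _ _)).
      by apply/negP; rewrite (disjointFr (grid_disjoint vi)).
    by rewrite !nz !orbF.
  have nz (x : {set I}) : (z \in [set v 0 i (i \in x) | i : I]) = false.
    by apply: contraFF zG => /(subsetP (pts_head_sub _ _)).
  by rewrite !nz.
have tail : @pts s (fun j => v j.+1) y.2 = @pts s (fun j => v j.+1) y'.2.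
  apply/setP => z; have := congr1 (fun X : {set V} => z \in X) e; rewrite /= !inE -head.
  case zG: (z \in grid s (fun j => v j.+1)); last first.
    have nz y0 : (z \in @pts s (fun j => v j.+1) y0) = false.
      by apply: contraFF zG => /(subsetP (pts_sub _ _)).
    by rewrite !nz.
  suff -> : (z \in [set v 0 i (i \in y.1) | i : I]) = false by [].
  apply: contraFF (disjointFl (grid_disjoint vi) zG); exact: (subsetP (pts_head_sub _ _)).
case: y y' e head tail => [x y] [x' y'] /= _ head /(IH _ (grid_injS vi)) ->.
congr (_, _); apply/setP => i; have := congr1 (fun X : {set V} => v 0 i true \in X) head.
have mem (z : {set I}) : (v 0 i true \in [set v 0 i (i \in z) | i : I]) = (i \in z).
  apply/imsetP/idP => [[i' _ /vi[]//]|iz]; last by exists i; rewrite ?iz.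
  by move=> _ -> <-.
by rewrite !mem.
Qed.

Lemma mkpairs_nseq s v i :
  mkpairs v (nseq s i) = [seq (v j i true, v j i false) | j <- iota 0 s].
Proof.
elim: s v => //= s IH v; rewrite IH; congr (_ :: _).
by rewrite (iotaDl 1 0 s) -map_comp.
Qed.

(** Adding i to the first factor swaps the endpoints of a pair, so a cube difference is one more
    pair appended to qs. The other indices of that factor join Z, which grows by |I| - 1 per factor
    and ends with K elements. *)
Lemma approx_grid (F : realType) (W : {set V}) (s0 K : nat) (nu : F)
    (phi : {set V} -> F) (kap : seq (V * V) -> F) :
  (forall qs (Z : {set V}), size qs = s0 -> good W qs Z -> #|Z| = K ->
     `|mdiff qs phi Z - kap qs| <= nu) ->
  forall s v qs (Z : {set V}), (size qs + s = s0)%N -> good W qs Z ->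
    (#|Z| + s * #|I|.-1 = K)%N -> grid_inj s v ->
    (forall j i b, (j < s)%N ->
       [&& v j i b \in W, v j i b \notin Z & v j i b \notin verts qs]) ->
    approx (fun l => kap (qs ++ mkpairs v l))
      (fun y : cube I s => mdiff qs phi (pts v y :|: Z)) nu.
Proof.
move=> base; elim=> [|s IH] v qs Z sq gZ cZ vi hv /=.
  by rewrite set0U cats0; apply: base; lia.
move=> x i ix.
pose p := (v 0 i true, v 0 i false).
pose Z0 := [set v 0 j (j \in x) | j in [set~ i]].
have I0 : (0 < #|I|)%N by apply/card_gt0P; exists i.
have e1 : [set v 0 j (j \in i |: x) | j : I] = p.1 |: Z0.
  apply/setP => z; rewrite !inE; apply/imsetP/orP => [[j _ ->]|].
    case: (j =P i) => [->|ji]; first by left; rewrite setU11.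
    right; apply/imsetP; exists j; first by rewrite !inE; apply/eqP.
    by rewrite !inE; case: eqP.
  case=> [/eqP ->|/imsetP[j ji ->]]; first by exists i; rewrite // setU11.
  by exists j => //; move: ji; rewrite !inE => /negPf ->.
have e2 : [set v 0 j (j \in x) | j : I] = p.2 |: Z0.
  apply/setP => z; rewrite !inE; apply/imsetP/orP => [[j _ ->]|].
    case: (j =P i) => [->|ji]; first by left; rewrite (negPf ix).
    by right; apply/imsetP; exists j; rewrite // !inE; apply/eqP.
  case=> [/eqP ->|/imsetP[j ji ->]]; first by exists i; rewrite // (negPf ix).
  by exists j.
have Z0v z : z \in Z0 -> exists2 jb : I * bool, jb.1 != i & z = v 0 jb.1 jb.2.
  by case/imsetP => j; rewrite !inE => ji ->; exists (j, j \in x).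
have dZ : [disjoint Z & Z0].
  rewrite disjoint_sym disjoint_subset; apply/subsetP => z /Z0v[[j b] _ ->].
  by rewrite inE; case/and3P: (hv 0 j b isT).
have cZ0 : #|Z0| = #|I|.-1.
  by rewrite card_imset ?cardsC1 // => j j' /vi[].
have gZ' : good W (rcons qs p) (Z :|: Z0).
  have [/and3P[w1 z1 q1] /and3P[w2 z2 q2]] := (hv 0 i true isT, hv 0 i false isT).
  have nZ0 b : v 0 i b \notin Z0.
    by apply/negP => /Z0v[[j b'] /= ji /vi[]// _ ij]; rewrite ij eqxx in ji.
  rewrite good_rcons /= !inE !negb_or w1 w2 z1 z2 q1 q2 !nZ0 !andbT /=.
  apply/andP; split; last by apply/eqP => /vi[].
  case/and4P: gZ => u sV sZ nZ; rewrite /good u sV subUset sZ /=.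
  apply/andP; split.
    by apply/subsetP => z /Z0v[[j b] _ ->]; case/and3P: (hv 0 j b isT).
  apply/allP => z zq; rewrite inE negb_or (allP nZ z zq) /=.
  by apply/negP => /Z0v[[j b] _ ez]; case/and3P: (hv 0 j b isT); rewrite /= -ez zq.
have := IH (fun j => v j.+1) (rcons qs p) (Z :|: Z0).
rewrite size_rcons => /(_ ltac:(lia) gZ').
rewrite cardsU (disjoint_setI0 dZ) cards0 subn0 cZ0 => /(_ ltac:(lia) (grid_injS vi)).
have hv' j i0 b : (j < s)%N ->
    [&& v j.+1 i0 b \in W, v j.+1 i0 b \notin Z :|: Z0
      & v j.+1 i0 b \notin verts (rcons qs p)].
  move=> js; have /and3P[w z q] := hv j.+1 i0 b js.
  rewrite w verts_rcons mem_cat !inE !negb_or z q /=.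
  have nv i' b' : v j.+1 i0 b != v 0 i' b' by apply/eqP => /vi[].
  by rewrite !nv !andbT; apply/negP => /Z0v[[j' b'] _ /eqP]; apply/negP.
move=> /(_ hv'); apply: approx_ext => // [l|y]; first by rewrite cat_rcons.
rewrite mdiff_rcons /pdiff e1 e2 -/p.
have AC (E R : {set V}) : E :|: (R :|: (Z :|: Z0)) = E :|: Z0 :|: R :|: Z.
  by rewrite [Z :|: _]setUC !setUA (setUAC E).
by rewrite !AC.
Qed.

End Grid.

(** * Anticoncentration on the slice *)

Lemma geometric_small (F : realType) (x e : F) :
  0 < x -> x <= 1 -> 0 < e -> exists n, (1 - x) ^+ n <= e.
Proof.
move=> x0 x1 e0; have [n hn] := archi_nat (e * x)^-1; exists n.
have bern : (1 - x) ^+ n * (1 + n%:R * x) <= 1.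
  elim: n {hn} => [|n IH]; first by rewrite expr0 mul0r addr0 mul1r.
  apply: le_trans IH; rewrite exprSr -mulrA ler_wpM2l ?exprn_ge0 ?subr_ge0 //.
  rewrite -natr1; have : 0 <= n%:R :> F by []. nra.
have ex0 : 0 < e * x by rewrite mulr_gt0.
have h : 1 <= e * (n%:R * x).
  by rewrite mulrCA -ler_pdivrMr // mul1r.
have p0 : 0 < 1 + n%:R * x by rewrite ltr_wpDr // mulr_ge0 // ltW.
rewrite -(ler_pM2r p0); apply: le_trans bern _; apply: le_trans h _.
by rewrite ler_pM2l // lerDr.
Qed.

Lemma card_cube_gt0 (I : finType) s : (0 < #|cube I s|)%N.
Proof.
apply/card_gt0P; suff [y _] : exists y : cube I s, true by exists y.
elim: s => [|s [y _]]; first by exists tt.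
by exists (set0, y).
Qed.

Section SliceAnticonc.
Variable F : realType.

Lemma mdiff_affine (V : finType) (qs : seq (V * V)) (phi : {set V} -> F)
    (l c : F) (A : {set V}) : (0 < size qs)%N ->
  mdiff qs (fun X => (phi X - l) / c) A = mdiff qs phi A / c.
Proof.
elim/last_ind: qs A => // qs p IH A _; rewrite !mdiff_rcons /pdiff.
case: qs IH => [|p' qs] IH; first by rewrite /=; ring.
by rewrite !IH //; ring.
Qed.

Lemma nth_verts (V : finType) (p0 : V * V) (x0 : V) (qs : seq (V * V)) j b :
  (j < size qs)%N -> nth x0 (verts qs) (j.*2 + ~~ b) =
    if b then (nth p0 qs j).1 else (nth p0 qs j).2.
Proof.
elim: qs j => //= p qs IH [|j] js; first by clear; case: b.
by rewrite doubleS !addSn /=; exact: IH.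
Qed.

Lemma size_verts (V : finType) (qs : seq (V * V)) : size (verts qs) = (size qs).*2.
Proof. by elim: qs => //= p qs IH; rewrite doubleS -IH. Qed.

(** Each of H blocks gathers M + 1 tuples. Given that the random set contains exactly one endpoint
    of every pair of a block, [cube_anticonc] applies to a rescaling of [ev a] - l; that no block is
    split this way has probability at most eps / 2. *)
Lemma slice_anticonc (r s q R : nat) (eps : F) :
  0 < eps -> (0 < s)%N -> (s <= r)%N -> (0 < R)%N ->
  exists h k0, forall (V : finType) (W : {set V}) (k : nat)
    (a : {set V} -> F) (l : F) (w : nat -> seq (V * V)) (A : nat -> {set V}),
    (forall S, a S \is a Num.int) -> (forall S, `|a S| <= q%:R) ->
    (forall S : {set V}, (r < #|S|)%N -> a S = 0) ->
    vanish r s.+1 W a ->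
    (forall i, (i < h)%N -> [/\ size (w i) = s, good W (w i) (A i),
        (#|A i| + s = r)%N & mdiff (w i) a (A i) != 0]) ->
    (forall i j x, (i < h)%N -> (j < h)%N ->
        x \in verts (w i) -> x \in verts (w j) -> i = j) ->
    (k0 <= k)%N -> (k <= #|W|)%N ->
    (#|W| <= R * k)%N -> (#|W| <= R * (#|W| - k))%N ->
    \sum_(X in slc W k) (ev a X == l)%:R <= eps * #|slc W k|%:R.
Proof.
move=> eps0 s0 sr R0; have e2 : 0 < eps / 2 by rewrite divr_gt0.
have [M AC] := cube_anticonc s e2.
pose I : finType := 'I_M.+1; pose c := (s * M.+1)%N.
(* A block has 2 c vertices, c of them chosen. The ratio is 2 R because the blocks may use up half
   of k and of |W| - k. *)
pose D := ((2 * R) ^ (c + c))%N.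
have D0 : 0 < D%:R :> F by rewrite ltr0n expn_gt0 muln_gt0 R0.
have [H HH] : exists H, (1 - D%:R^-1) ^+ H <= eps / 2.
  apply: geometric_small => //; first by rewrite invr_gt0.
  by rewrite invf_le1 // ler1n -(ltr0n F).
pose t := (r - s)%N.
(* With K = k - s, [noise] bounds (K - t) nu (2 |I|)^s, by [bin_lower_sum]. *)
pose noise := (2 ^ s * q * (t * t) * (2 * M.+1) ^ s)%N.
(* The threshold keeps k and |W| - k at least twice the total size of the blocks, and K - t above
   [noise]. *)
exists (H * M.+1)%N, (R * (2 * (H * (c + c))) + 2 * (H * (c + c)) + c + 2 * r + noise.+1)%N.
move=> V W k a l w A ai aq deg van hw hdis kk0 kW WR WR'.
have [x0 x0W] : exists x, x \in W.
  by apply/card_gt0P; lia.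
pose p0 := (x0, x0).
pose v (g j : nat) (i : I) (b : bool) : V :=
  let p := nth p0 (w (g * M.+1 + i)) j in if b then p.1 else p.2.
have idx g (i : I) : (g < H)%N -> (g * M.+1 + i < H * M.+1)%N.
  move=> gH; have iM := ltn_ord i; apply: leq_trans (_ : g.+1 * M.+1 <= _)%N.
    by rewrite mulSn addnC ltn_add2r.
  by rewrite leq_mul2r gH orbT.
have vE g j i b : (g < H)%N -> (j < s)%N ->
    v g j i b = nth x0 (verts (w (g * M.+1 + i))) (j.*2 + ~~ b).
  move=> gH js; rewrite (nth_verts p0) //.
  by have [-> _ _ _] := hw _ (idx g i gH).
have jb_lt j b : (j < s)%N -> (j.*2 + ~~ b < s.*2)%N by case: b => /=; lia.
have v_in g j i b : (g < H)%N -> (j < s)%N ->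
    v g j i b \in verts (w (g * M.+1 + i)).
  move=> gH js; rewrite vE // mem_nth // size_verts.
  by have [-> _ _ _] := hw _ (idx g i gH); exact: jb_lt.
have idx_inj g g' (i i' : I) :
    (g * M.+1 + i = g' * M.+1 + i')%N -> g = g' /\ i = i'.
  move=> e; have iM := ltn_ord i; have i'M := ltn_ord i'.
  have eg : g = g'.
    by have := congr1 (fun n => n %/ M.+1)%N e; rewrite !divnMDl // !divn_small ?addn0.
  by split => //; apply: val_inj => /=; move: e; rewrite eg => /addnI.
have vi g : (g < H)%N -> grid_inj s (v g).
  move=> gH j j' i i' b b' js j's e.
  have h1 := v_in g j i b gH js; have h2 := v_in g j' i' b' gH j's.
  rewrite -e in h2.
  have [_ ii] := idx_inj _ _ _ _ (hdis _ _ _ (idx g i gH) (idx g i' gH) h1 h2).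
  move: e; rewrite -ii !vE //.
  have [sz /and4P[u _ _ _] _ _] := hw _ (idx g i gH).
  move/eqP; rewrite nth_uniq ?size_verts ?sz ?jb_lt // => /eqP e.
  have eb : b = b'.
    by have := congr1 odd e; rewrite !oddD !odd_double !oddb /=; case: b b' {e h1 h2} => -[].
  by split => //; move: e; rewrite eb => /addIn /double_inj.
have vW g j i b : (g < H)%N -> (j < s)%N -> v g j i b \in W.
  move=> gH js; have [_ /and4P[_ sW _ _] _ _] := hw _ (idx g i gH).
  exact: (allP sW) (v_in g j i b gH js).
have cI : #|I| = M.+1 by rewrite card_ord.
pose P := fun X => ev a X == l.
apply: (@le_trans _ _ ((eps / 2 + (1 - D%:R^-1) ^+ H) * #|slc W k|%:R)); last first.
  rewrite ler_wpM2r //; lra.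
have WkH : (H * (c + c) * 2 <= #|W| - k)%N.
  rewrite leqNgt; apply/negP => lt.
  have := leq_mul (leqnn R) (ltnW lt); lia.
have k2 : (k <= 2 * (k - H * (c + c)))%N by lia.
have Wk2 : (#|W| - k <= 2 * (#|W| - k - H * (c + c)))%N by lia.
apply: (@blocks_anticonc F V (cube I s) (2 * R) c (eps / 2) H W k
  (fun g => @pts V I s (v g)) (fun g => grid s (v g)) P).
- by rewrite muln_gt0 R0.
- exact: card_cube_gt0.
- exact: ltW.
- by move=> g y gH; split; [exact: pts_sub|rewrite card_pts ?cI //; exact: vi].
- by move=> g gH; apply: pts_inj; exact: vi.
- move=> g gH; rewrite card_grid ?cI; last exact: vi.
  split => //; apply/subsetP => x /gridP[j [i [b [js ->]]]]; exact: vW.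
- move=> g g' /andP[gg' g'H]; have gH := ltn_trans gg' g'H.
  rewrite disjoint_subset; apply/subsetP => x /gridP[j [i [b [js ->]]]].
  rewrite inE; apply/negP => /gridP[j' [i' [b' [j's e]]]].
  have h1 := v_in g j i b gH js; have h2 := v_in g' j' i' b' g'H j's.
  rewrite -e in h2.
  have [eg _] := idx_inj _ _ _ _ (hdis _ _ _ (idx g i gH) (idx g' i' g'H) h1 h2).
  by rewrite eg ltnn in gg'.
- lia.
- lia.
- by apply: leq_trans WR _; rewrite [(2 * R)%N]mulnC -mulnA leq_mul2l k2 orbT.
- by apply: leq_trans WR' _; rewrite [(2 * R)%N]mulnC -mulnA leq_mul2l Wk2 orbT.
move=> g Z gH; rewrite subsetD => /andP[sZ dZ] cZ.
(* An s-fold difference leaves s elements of the random set undecided, so its base set has K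
   elements; N counts the subsets of size t in it, and dividing by N brings the differences near
   integers. *)
pose K := (k - s)%N; pose N : F := 'C(K, t)%:R.
have tK : (t + t <= K)%N by rewrite /t /K; move: kk0 sr; clear; lia.
have N0 : 0 < N by rewrite ltr0n bin_gt0; apply: leq_trans tK; exact: leq_addr.
pose nu : F := 2 ^+ s * q%:R * (\sum_(j < t) 'C(K, j))%:R / N.
have nu0 : 0 <= nu by rewrite divr_ge0 ?mulr_ge0 ?exprn_ge0 ?ler0n.
pose kap l := kappaV r W a (mkpairs (v g) l).
have diag i : kap (nseq s i) = mdiff (w (g * M.+1 + i)) a (A (g * M.+1 + i)%N).
  have [sz gd cA _] := hw _ (idx g i gH).
  rewrite /kap mkpairs_nseq.
  have -> : [seq (v g j i true, v g j i false) | j <- iota 0 s]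
            = w (g * M.+1 + i)%N.
    rewrite -[RHS](mkseq_nth p0) sz; apply: eq_map => j.
    by rewrite /v -surjective_pairing.
  by apply: kappaVE; rewrite ?sz.
have ap : approx kap (fun y : cube I s => (ev a (pts (v g) y :|: Z) - l) / N) nu.
  have base qs (Z' : {set V}) : size qs = s -> good W qs Z' -> #|Z'| = K ->
      `|mdiff qs (fun X => (ev a X - l) / N) Z' - kappaV r W a qs| <= nu.
    move=> sz gd cZ'; rewrite mdiff_affine ?sz //.
    have := @mdiff_ev_approx F V r W a qs Z' q%:R aq deg.
    rewrite sz cZ' -/t -/N => /(_ van gd sr) h.
    have -> : mdiff qs (ev a) Z' / N - kappaV r W a qs =
              (mdiff qs (ev a) Z' - kappaV r W a qs * N) / N.
      by rewrite mulrBl mulfK // gt_eqF.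
    by rewrite normrM normfV (gtr0_norm N0) ler_pM2r ?invr_gt0.
  have := @approx_grid V I F W s K nu _ _ base s (v g) [::] Z.
  apply => //.
  - by rewrite /good /= sZ.
  - by rewrite cZ cI /K; move: kk0; rewrite /c mulnS; clear; lia.
  - exact: vi.
  move=> j i b js; rewrite vW //= andbT.
  rewrite (disjointFl dZ) //; apply/gridP; by exists j, i, b.
have := AC I kap _ nu setT _ _ _ nu0 ap.
rewrite cardsT cI => /(_ (leqnSn M)) h.
have {}h := h (fun l => kappaV_int _ _ _ ai).
have {}h := h ltac:(by move=> i _; rewrite diag; have [_ _ _ nz] := hw _ (idx g i gH)).
have small : nu * (2 * M.+1)%:R ^+ s < 1.
  have Kt : (noise < K - t)%N by rewrite /K /t; move: kk0 sr; clear; lia.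
  have hb := bin_lower_sum tK.
  rewrite /nu mulrAC ltr_pdivrMr // mul1r -!natrX -!natrM ltr_nat.
  have Kt0 : (0 < K - t)%N by apply: leq_ltn_trans Kt.
  rewrite -(ltn_pmul2l Kt0) mulnAC mulnCA.
  apply: (@leq_ltn_trans (2 ^ s * q * (2 * M.+1) ^ s * (t * t * 'C(K, t)))%N).
    by rewrite leq_mul2l hb orbT.
  have -> : (2 ^ s * q * (2 * M.+1) ^ s * (t * t * 'C(K, t)) = noise * 'C(K, t))%N.
    by rewrite /noise; ring.
  by rewrite ltn_pmul2r // bin_gt0; apply: leq_trans tK; exact: leq_addr.
move/(_ small): h; rewrite card_set_sum; apply: le_trans.
apply: ler_sum => y _; rewrite ler_nat /P; case: eqP => // ->.
by rewrite subrr mul0r eqxx.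
Qed.

End SliceAnticonc.

(** * Restriction to fewer variables, and hitting sets *)

Section Restriction.
Variables (F : realType) (V : finType).
Implicit Types (a : {set V} -> F) (S X Y T : {set V}).

(* On sets disjoint from Y: the coefficients after setting the variables of Y
   to 1. *)
Definition red a Y S : F := \sum_(T in powerset Y) a (S :|: T).

Lemma big_powersetU (R : nmodType) X Y (G : {set V} -> R) :
  [disjoint X & Y] ->
  \sum_(P in powerset (X :|: Y)) G P =
  \sum_(S in powerset X) \sum_(T in powerset Y) G (S :|: T).
Proof.
have [n] := ubnP #|Y|; elim: n => // n IH in Y G *; rewrite ltnS => Yn dXY.
have [->|[y yY]] := set_0Vmem Y.
  by rewrite setU0; apply: eq_bigr => S _; rewrite powerset0 big_set1 setU0.
have yX : y \notin X by rewrite (disjointFl dXY).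
have ny : y \notin Y :\ y by rewrite !inE eqxx.
have d' : [disjoint X & Y :\ y] by apply: disjointWr dXY; exact: subD1set.
rewrite -{1}(setD1K yY) setUCA big_powersetU1; last by rewrite inE negb_or yX.
rewrite (IH (Y :\ y)) //; last by move: Yn; rewrite (cardsD1 y) yY add1n.
apply: eq_bigr => S _; rewrite -{2}(setD1K yY) big_powersetU1 //.
by apply: eq_bigr => T _; rewrite setUCA.
Qed.

Lemma red0 a S : red a set0 S = a S.
Proof. by rewrite /red powerset0 big_set1 setU0. Qed.

Lemma ev_red a X Y : [disjoint X & Y] -> ev (red a Y) X = ev a (X :|: Y).
Proof. by move=> d; rewrite /ev big_powersetU. Qed.

Lemma red_red a Y Y' S : [disjoint Y & Y'] ->
  red (red a Y) Y' S = red a (Y :|: Y') S.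
Proof.
move=> d; rewrite /red big_powersetU // exchange_big.
by apply: eq_bigr => T _; apply: eq_bigr => T' _; rewrite setUA setUAC.
Qed.

Lemma red_int a Y S : (forall S, a S \is a Num.int) -> red a Y S \is a Num.int.
Proof. by move=> h; apply: rpred_sum. Qed.

Lemma red_bound a Y S (q : nat) : (forall S, `|a S| <= q%:R) ->
  `|red a Y S| <= (2 ^ #|Y| * q)%:R.
Proof.
move=> h; apply: le_trans (ler_norm_sum _ _ _) _.
apply: le_trans (ler_sum _ (fun T _ => h (S :|: T))) _.
by rewrite sumr_const card_powerset mulnC natrM mulr_natr.
Qed.

Lemma red_deg a r Y S : (forall S, (r < #|S|)%N -> a S = 0) ->
  (r < #|S|)%N -> red a Y S = 0.
Proof.
move=> h rS; rewrite /red big1 // => T _; apply: h; apply: leq_trans rS _.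
by apply: subset_leq_card; exact: subsetUl.
Qed.

(** A nonempty T would push [S :|: T] above the degree r. *)
Lemma red_top a r Y S : (forall S, (r < #|S|)%N -> a S = 0) ->
  #|S| = r -> [disjoint S & Y] -> red a Y S = a S.
Proof.
move=> h cS d; rewrite /red (bigD1 set0) ?powersetE ?sub0set //= setU0.
rewrite big1 ?addr0 // => T /andP[]; rewrite powersetE => sT nT; apply: h.
rewrite cardsU (disjoint_setI0 (disjointWr sT d)) cards0 subn0 cS.
by rewrite -addn1 leq_add2l card_gt0.
Qed.

(** Averaging over the traces on Y: a probability above eps stays above eps for some trace. *)
Lemma best_pattern (W Y : {set V}) k a (l eps : F) : Y \subset W ->
  eps * #|slc W k|%:R < \sum_(X in slc W k) (ev a X == l)%:R ->
  exists Y1 : {set V}, [/\ Y1 \subset Y, (#|Y1| <= k)%N &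
    eps * #|slc (W :\: Y) (k - #|Y1|)|%:R <
      \sum_(X in slc (W :\: Y) (k - #|Y1|)) (ev (red a Y1) X == l)%:R].
Proof.
move=> sYW; rewrite -[X in _ * X%:R]sum1_card natr_sum !(sum_slc_split _ _ sYW) => lt.
have [/exists_inP[P]|none] := boolP [exists P in powerset Y, (#|P| <= k)%N &&
    (eps * #|slc (W :\: Y) (k - #|P|)|%:R <
      \sum_(X in slc (W :\: Y) (k - #|P|)) (ev (red a P) X == l)%:R)].
  by rewrite powersetE => sP /andP[Pk ltP]; exists P.
move: lt; rewrite ltNge; case/negP; rewrite mulr_sumr; apply: ler_sum => P.
rewrite powersetE => /andP[sP Pk].
move: none; rewrite negb_exists_in => /forall_inP/(_ P).
rewrite powersetE sP Pk -leNgt /= => /(_ isT).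
rewrite -[X in _ * X%:R]sum1_card natr_sum; apply: le_trans.
rewrite le_eqVlt; apply/orP; left; apply/eqP; apply: eq_bigr => X.
rewrite inE subsetD => /andP[/andP[_ dX] _].
by rewrite ev_red 1?setUC // (disjointWr sP).
Qed.

End Restriction.

(** Greedy choice: as long as some support avoids the union Y of those already chosen, add it;
    otherwise Y meets every support. *)
Lemma packing (Wt : Type) (V : finType) (W : {set V}) (P : Wt -> Prop)
    (supp : Wt -> {set V}) (m : nat) (w0 : Wt) :
  (forall w, P w -> supp w \subset W /\ (#|supp w| <= m)%N) ->
  forall h,
  (exists w : nat -> Wt, (forall i, (i < h)%N -> P (w i)) /\
     forall i j x, (i < h)%N -> (j < h)%N ->
       x \in supp (w i) -> x \in supp (w j) -> i = j) \/
  (exists Y : {set V}, [/\ Y \subset W, (#|Y| <= h * m)%N &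
     forall w, P w -> ~~ [disjoint supp w & Y]]).
Proof.
move=> hP h.
suff [[w [Y [hw hd _ _ _]]]|hit] :
  (exists (w : nat -> Wt) (Y : {set V}), [/\ (forall i, (i < h)%N -> P (w i)),
     forall i j x, (i < h)%N -> (j < h)%N ->
       x \in supp (w i) -> x \in supp (w j) -> i = j,
     Y \subset W, (#|Y| <= h * m)%N &
     forall i, (i < h)%N -> supp (w i) \subset Y]) \/
  (exists Y : {set V}, [/\ Y \subset W, (#|Y| <= h * m)%N &
     forall w, P w -> ~~ [disjoint supp w & Y]]).
- by left; exists w.
- by right.
elim: h => [|h [[w [Y [hw hd sY cY hs]]]|[Y [sY cY hit]]]].
- by left; exists (fun=> w0), set0; split; rewrite ?sub0set ?cards0.
- have cYm : (#|Y| <= h.+1 * m)%N by rewrite mulSn (leq_trans cY) ?leq_addl.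
  have [[w' [Pw' dw']]|no] :=
      Classical_Prop.classic (exists w', P w' /\ [disjoint supp w' & Y]); last first.
    right; exists Y; split => // w' Pw'; apply/negP => d; apply: no.
    by exists w'.
  left; exists (fun i => if i == h then w' else w i), (Y :|: supp w').
  have [sW' cW'] := hP _ Pw'.
  have lt i : (i < h.+1)%N -> i != h -> (i < h)%N.
    by rewrite ltnS leq_eqVlt => /orP[->|].
  have out i x : (i < h)%N -> x \in supp (w i) -> x \in supp w' -> False.
    move=> ih /(subsetP (hs i ih)) xY xw.
    by rewrite (disjointFr dw' xw) in xY.
  split.
  + move=> i ih; case: eqP => // /eqP ne; apply: hw; exact: lt.
  + move=> i j x ih jh; case: eqP => [->|/eqP ni]; case: eqP => [->|/eqP nj] //.
    * by move=> x1 x2; case: (out j x); rewrite ?lt.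
    * by move=> x1 x2; case: (out i x); rewrite ?lt.
    * by apply: hd; exact: lt.
  + by rewrite subUset sY sW'.
  + rewrite mulSn addnC; apply: leq_trans (leq_card_setU _ _) _; exact: leq_add.
  + move=> i ih; case: eqP => [_|/eqP ne]; first exact: subsetUr.
    by apply: subset_trans (hs _ (lt i ih ne)) (subsetUl _ _).
- right; exists Y; split => //; apply: leq_trans cY _.
  by rewrite leq_mul2r leqnSn orbT.
Qed.

(** * Induction on the degree and on the order of vanishing differences *)

Section Structure.
Variable F : realType.

(** Y is the set of fixed variables, Y1 those set to 1. The value is recorded by a point X of the
    remaining slice where it is attained, which also shows that this slice is nonempty. *)
Definition structured (V : finType) (W : {set V}) (k : nat)
    (a : {set V} -> F) (l : F) (C : nat) : Prop :=
  exists Y Y1 : {set V},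
    [/\ Y1 \subset Y, Y \subset W, (#|Y| <= C)%N, (#|Y1| <= k)%N &
     (exists c : nat -> F, forall S : {set V}, S \subset W :\: Y ->
        red a Y1 S = c #|S|) /\
     (exists2 X, X \in slc (W :\: Y) (k - #|Y1|) & ev (red a Y1) X = l)].

(** The two balance conditions replace the range of n: for large k they survive fixing boundedly
    many variables at the price of doubling R. *)
Definition dichotomy (r s : nat) : Prop :=
  forall (q R : nat) (eps : F), 0 < eps -> (0 < R)%N ->
  exists C k0, forall (V : finType) (W : {set V}) (k : nat)
    (a : {set V} -> F) (l : F),
    (forall S, a S \is a Num.int) -> (forall S, `|a S| <= q%:R) ->
    (forall S : {set V}, (r < #|S|)%N -> a S = 0) ->
    vanish r s W a ->
    (k0 <= k)%N -> (#|W| <= R * k)%N -> (#|W| <= R * (#|W| - k))%N ->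
    eps * #|slc W k|%:R < \sum_(X in slc W k) (ev a X == l)%:R ->
    structured W k a l C.

Lemma positive_hit (V : finType) (A : {set {set V}}) (phi : pred {set V}) (eps : F) :
  0 < eps -> eps * #|A|%:R < \sum_(X in A) (phi X)%:R ->
  exists2 X, X \in A & phi X.
Proof.
move=> e0 lt; apply/exists_inP; apply: contraTT lt; rewrite negb_exists_in -leNgt.
move=> /forall_inP none; rewrite big1 ?mulr_ge0 ?(ltW e0) // => X XA.
by rewrite (negPf (none X XA)).
Qed.

(** No A satisfies |A| + (r + 1) = r, so [dichotomy r r.+1] restricts no differences. *)
Lemma vanish_high (V : finType) r (W : {set V}) (a : {set V} -> F) :
  vanish r r.+1 W a.
Proof. by move=> qs A _ _; lia. Qed.

Lemma dichotomy0 s : dichotomy 0 s.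
Proof.
move=> q R eps e0 R0; exists 0, 0 => V W k a l ai aq deg _ _ _ _ lt.
exists set0, set0; rewrite cards0 subn0 setD0 !sub0set; split => //; split.
  exists (fun d => if d == 0 then a set0 else 0) => S _; rewrite red0.
  have [/eqP|ne] := eqVneq #|S| 0; first by rewrite cards_eq0 => /eqP ->.
  by rewrite deg // lt0n.
have [X XA /eqP e] := positive_hit (phi := fun X => ev a X == l) e0 lt.
by exists X => //; rewrite -e /ev; apply: eq_bigr => S _; rewrite red0.
Qed.

(** At order 1 the common value c0 is the coefficient of every monomial of degree r + 1 inside W, so
    the top part equals c0 C(k, r + 1) on the slice and is absorbed in l. *)
Lemma dichotomy_lower r : dichotomy r r.+1 -> dichotomy r.+1 1.
Proof.
move=> IH q R eps e0 R0; have [C [k0 H]] := IH q R eps e0 R0.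
exists C, k0 => V W k a l ai aq deg van kk0 WR WR' lt.
pose c0 := kappaV r.+1 W a [::].
have topE (S : {set V}) : S \subset W -> #|S| = r.+1 -> a S = c0.
  move=> sS cS; rewrite /c0 (@kappaVE _ _ _ _ _ _ S) //; last by rewrite addn0.
  by rewrite /good /= sS.
pose a' (S : {set V}) := if #|S| == r.+1 then 0 else a S.
have split (S : {set V}) : S \subset W -> a S = a' S + c0 *+ (#|S| == r.+1).
  move=> sS; rewrite /a'; case: eqP => [cS|_]; last by rewrite addr0.
  by rewrite add0r topE.
have evE X : X \in slc W k -> ev a X = ev a' X + c0 * 'C(k, r.+1)%:R.
  rewrite inE => /andP[sX /eqP cX]; rewrite /ev.
  have -> : c0 * 'C(k, r.+1)%:R = \sum_(S in powerset X) c0 *+ (#|S| == r.+1).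
    rewrite -cX -cards_draws -sum1_card natr_sum mulr_sumr big_mkcond /=.
    rewrite [RHS]big_mkcond; apply: eq_bigr => S _; rewrite inE powersetE mulr1.
    by case: (S \subset X); case: (_ == _).
  rewrite -big_split; apply: eq_bigr => S; rewrite powersetE => sS.
  by rewrite split // (subset_trans sS).
pose l' := l - c0 * 'C(k, r.+1)%:R.
have hitE X : X \in slc W k -> (ev a X == l) = (ev a' X == l').
  by move=> Xs; rewrite evE // eq_sym -subr_eq eq_sym.
have [Y [Y1 [sY1 sY cY cY1 [[c cE] [X Xs eX]]]]] : structured W k a' l' C.
  apply: H => //.
  - by move=> S; rewrite /a'; case: ifP => // _; exact: rpred0.
  - by move=> S; rewrite /a'; case: ifP => // _; rewrite normr0 ler0n.
  - move=> S rS; rewrite /a'; case: eqP => // /eqP ne; apply: deg.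
    by rewrite ltn_neqAle eq_sym ne.
  - exact: vanish_high.
  - rewrite (eq_bigr (fun X => (ev a X == l)%:R)) // => Z Zs.
    by rewrite hitE.
exists Y, Y1; split => //; split; last first.
  exists X => //; move: (Xs); rewrite inE subsetD => /andP[/andP[sXW dXY] /eqP cX].
  have dXY1 := disjointWr sY1 dXY.
  move: eX; rewrite !ev_red // evE; last first.
    rewrite inE subUset sXW (subset_trans sY1 sY) /=.
    by rewrite cardsU (disjoint_setI0 dXY1) cards0 subn0 cX subnK.
  by move=> ->; rewrite /l' subrK.
(* The second summand restores the removed top part: it counts the subsets of Y1 completing S to
   size r + 1. The test guards against truncated subtraction, which would give the binomial 1 for d
   > r + 1. *)
exists (fun d => c d + c0 *+ (if (d <= r.+1)%N then 'C(#|Y1|, r.+1 - d) else 0)).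
move=> S sS; rewrite -cE //; move: sS; rewrite subsetD => /andP[sSW dSY].
have dSY1 := disjointWr sY1 dSY.
have cSU T : T \in powerset Y1 -> #|S :|: T| = (#|S| + #|T|)%N.
  rewrite powersetE => sT.
  by rewrite cardsU (disjoint_setI0 (disjointWr sT dSY1)) cards0 subn0.
rewrite /red; under eq_bigr => T TY.
  rewrite split; last first.
    rewrite subUset sSW (subset_trans _ (subset_trans sY1 sY)) //.
    by rewrite -powersetE.
  over.
rewrite big_split /= sumrMnr; congr (_ + _ *+ _).
rewrite (eq_bigr (fun T : {set V} => (#|S| + #|T| == r.+1)%N : nat)); last first.
  by move=> T TY; rewrite cSU.
case: leqP => Sr; last first.
  by rewrite big1 // => T _; case: eqP => // e; rewrite -e ltnNge leq_addr in Sr.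
rewrite -cards_draws -[RHS]sum1_card big_mkcond [RHS]big_mkcond /=.
apply: eq_bigr => T _; rewrite powersetE inE; case: (_ \subset _) => //=.
have <- : (#|S| + #|T| == r.+1)%N = (#|T| == r.+1 - #|S|)%N.
  by rewrite -[RHS](eqn_add2l #|S|) subnKC.
by case: (_ == _).
Qed.

Lemma dichotomy_step r s : (0 < s)%N -> (s <= r)%N ->
  dichotomy r s -> dichotomy r s.+1.
Proof.
move=> s0 sr IH q R eps e0 R0.
have [h [k1 AC]] := slice_anticonc q e0 s0 sr R0.
(* A bound for the hitting set: each tuple and its set have at most 2 s + r elements together. *)
pose y := (h * (s.*2 + r))%N.
(* Summing over subsets of Y1 multiplies the coefficient bound by at most 2^y; fixing Y at most
   halves k and |W| - k, hence 2 R. *)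
have [C [k0 H]] := IH (2 ^ y * q)%N (2 * R)%N eps e0 ltac:(by rewrite muln_gt0).
exists (y + C)%N, (k1 + k0 + 2 * y + R * (2 * y) + 1)%N.
move=> V W k a l ai aq deg van kk WR WR' lt.
have kW : (k <= #|W|)%N.
  have [X] := positive_hit (phi := fun X => ev a X == l) e0 lt.
  by rewrite inE => /andP[sX /eqP <-] _; exact: subset_leq_card.
pose P (w : seq (V * V) * {set V}) := [/\ size w.1 = s, good W w.1 w.2,
  (#|w.2| + s = r)%N & mdiff w.1 a w.2 != 0].
pose supp (w : seq (V * V) * {set V}) := [set x in verts w.1] :|: w.2.
have hP w : P w -> supp w \subset W /\ (#|supp w| <= s.*2 + r)%N.
  case=> sz gd cA _; have /and4P[_ sW sA _] := gd; split.
    rewrite subUset sA andbT; apply/subsetP => x; rewrite inE; exact: (allP sW).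
  apply: leq_trans (leq_card_setU _ _) _; apply: leq_add.
    by rewrite cardsE (leq_trans (card_size _)) // size_verts sz.
  by rewrite -cA leq_addr.
have [[w [hw hd]]|[Y [sY cY hit]]] := @packing _ V W P supp _ ([::], set0) hP h.
  have := AC V W k a l (fun i => (w i).1) (fun i => (w i).2) ai aq deg van hw.
  have dis i j x : (i < h)%N -> (j < h)%N ->
      x \in verts (w i).1 -> x \in verts (w j).1 -> i = j.
    by move=> ih jh x1 x2; apply: (hd i j x ih jh); rewrite !inE ?x1 ?x2.
  move=> /(_ dis ltac:(move: kk; clear; lia) kW WR WR').
  by rewrite leNgt lt.
have [Y1 [sY1 cY1 lt1]] := best_pattern sY lt.
have cY1y : (#|Y1| <= #|Y|)%N by exact: subset_leq_card.
have cW' : #|W :\: Y| = (#|W| - #|Y|)%N by rewrite cardsDS.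
have WkY : (2 * y <= #|W| - k)%N.
  rewrite leqNgt; apply/negP => ltWk.
  have := leq_mul (leqnn R) (ltnW ltWk); move: kk kW WR'; clear; lia.
have bal : (#|W :\: Y| <= 2 * R * (k - #|Y1|))%N.
  rewrite cW' (leq_trans (leq_subr _ _)) // (leq_trans WR) //.
  rewrite [(2 * R)%N]mulnC -mulnA leq_mul2l; apply/orP; right.
  move: kk cY cY1y; rewrite -/y; clear; lia.
have bal' : (#|W :\: Y| <= 2 * R * (#|W :\: Y| - (k - #|Y1|)))%N.
  rewrite cW' (leq_trans (leq_subr _ _)) // (leq_trans WR') //.
  rewrite [(2 * R)%N]mulnC -mulnA leq_mul2l; apply/orP; right.
  move: WkY kk cY cY1y; rewrite -/y; clear; lia.
(* The top coefficients outside Y are unchanged, and a nonzero difference there would come from a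
   tuple that Y fails to meet. *)
have van1 : vanish r s (W :\: Y) (red a Y1).
  move=> qs A sz gd cA.
  rewrite (@mdiff_congr F V (W :\: Y) r _ a) ?sz //; last first.
    move=> S; rewrite subsetD => /andP[_ dS] cS.
    by apply: red_top cS _ => //; exact: disjointWr dS.
  apply/eqP; apply: contraT => nz.
  have gdW : good W qs A.
    case/and4P: gd => u sW sA nA; rewrite /good u nA andbT /=; apply/andP; split.
      by apply/allP => x /(allP sW); rewrite !inE => /andP[].
    by apply: subset_trans sA (subsetDl _ _).
  have := hit (qs, A) (And4 sz gdW cA nz); case/negP.
  rewrite disjoint_subset; apply/subsetP => x; rewrite !inE /=.
  case/and4P: gd => _ sW sA _; case/orP => [/(allP sW)|/(subsetP sA)];
    by rewrite !inE => /andP[].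
have [||||Y' [Y1' [sY1' sY' cY' cY1' [[c cE] [X Xs eX]]]]] :=
  H V (W :\: Y) (k - #|Y1|)%N (red a Y1) l _ _ _ van1 _ bal bal' lt1.
- by move=> S; exact: red_int.
- move=> S; apply: le_trans (red_bound _ _ aq) _; rewrite ler_nat leq_mul2r.
  by rewrite leq_pexp2l ?orbT // (leq_trans cY1y).
- by move=> S; exact: red_deg.
- move: kk cY cY1y; rewrite -/y; clear; lia.
have dYY' : [disjoint Y1 & Y1'].
  move: (subset_trans sY1' sY'); rewrite subsetD disjoint_sym => /andP[_ d].
  exact: disjointWl sY1 d.
have cU : #|Y1 :|: Y1'| = (#|Y1| + #|Y1'|)%N.
  by rewrite cardsU (disjoint_setI0 dYY') cards0 subn0.
exists (Y :|: Y'), (Y1 :|: Y1'); rewrite -setDDl cU subnDA; split.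
- exact: setUSS.
- by rewrite subUset sY (subset_trans sY') // subsetDl.
- by apply: leq_trans (leq_card_setU _ _) _; exact: leq_add.
- by rewrite -leq_subRL.
split; first by exists c => S sS; rewrite -red_red // cE.
exists X => //; rewrite -eX /ev; apply: eq_bigr => S _.
by rewrite red_red.
Qed.

(** For each positive degree the order climbs from 1, supplied by the previous degree, to the degree
    plus one, where [vanish_high] makes the condition void. *)
Lemma dichotomy_all r : dichotomy r r.+1.
Proof.
elim: r => [|r IH]; first exact: dichotomy0.
suff h s : (s <= r.+1)%N -> dichotomy r.+1 s.+1 by apply: h.
elim: s => [_|s IHs sr]; first exact: dichotomy_lower.
by apply: dichotomy_step => //; apply: IHs; exact: ltnW.
Qed.

End Structure.

(** * Multilinear polynomials as coefficient functions on sets *)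

Section MultilinearPolynomials.
Variables (F : realType) (n : nat).
Implicit Types (S X Y : {set 'I_n}) (f : {mpoly F[n]}).

Definition set_mnm S : 'X_{1..n} := [multinom nat_of_bool (i \in S) | i < n].

Definition mnm_set (m : 'X_{1..n}) : {set 'I_n} := [set i | m i == 1%N].

Lemma set_mnmK : cancel set_mnm mnm_set.
Proof. by move=> S; apply/setP => i; rewrite !inE mnmE; case: (i \in S). Qed.

Lemma mnm_setK m : multilinear_mnm m -> set_mnm (mnm_set m) = m.
Proof.
move=> /forallP h; apply/mnmP => i; rewrite mnmE inE.
by move: (h i); case: (m i) => [|[]].
Qed.

Lemma set_mnm_multilinear S : multilinear_mnm (set_mnm S).
Proof. by apply/forallP => i; rewrite mnmE leq_b1. Qed.

Lemma mdeg_set_mnm S : mdeg (set_mnm S) = #|S|.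
Proof.
rewrite mdegE -sum1_card [RHS]big_mkcond /=; apply: eq_bigr => i _.
by rewrite mnmE; case: (i \in S).
Qed.

Definition coefs f S : F := f@_(set_mnm S).

Lemma multilinear_sum f : multilinear f ->
  f = \sum_(S : {set 'I_n}) coefs f S *: 'X_[set_mnm S].
Proof.
move=> mf; apply/mpolyP => m; rewrite raddf_sum /=.
have [ml|nml] := boolP (multilinear_mnm m); last first.
  rewrite (memN_msupp_eq0 (contra (mf m) nml)) big1 // => S _.
  rewrite mcoeffZ mcoeffX; case: eqP => [e|]; last by rewrite mulr0.
  by rewrite -e set_mnm_multilinear in nml.
rewrite (bigD1 (mnm_set m)) //= mcoeffZ mcoeffX mnm_setK // eqxx mulr1.
rewrite /coefs mnm_setK // big1 ?addr0 // => S ne.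
rewrite mcoeffZ mcoeffX; case: eqP => [e|]; last by rewrite mulr0.
by rewrite -e set_mnmK eqxx in ne.
Qed.

(** On 0/1 vectors the monomial of S is 1 when S lies in the support of x, and 0 otherwise. *)
Lemma eval01E f (x : {ffun 'I_n -> bool}) : multilinear f ->
  eval01 f x = ev (coefs f) [set i | x i].
Proof.
move=> mf; rewrite /eval01 {1}(multilinear_sum mf) raddf_sum /= /ev.
rewrite [RHS]big_mkcond; apply: eq_bigr => S _; rewrite mevalZ mevalX powersetE.
case: ifP => [sS|/negbT/subsetPn[i iS]].
  rewrite big1 ?mulr1 // => i _; rewrite mnmE.
  by case iS: (i \in S); rewrite ?expr0 //; move/(subsetP sS): iS; rewrite inE => ->.
rewrite inE => /negPf xi; rewrite (bigD1 i) //= mnmE iS xi expr1 mul0r mulr0 //.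
Qed.

Lemma coefs_deg r f S : degree_le r f -> (r < #|S|)%N -> coefs f S = 0.
Proof.
move=> df rS; apply: memN_msupp_eq0; apply/negP => /msize_mdeg_lt.
rewrite mdeg_set_mnm => lt; have := leq_trans lt df; lia.
Qed.

End MultilinearPolynomials.

(** Subsets of X are grouped by size. This turns the point kept in [structured] into the sum asked
    for by [constantly]. *)
Lemma ev_constant (F : realType) (V : finType) (b : {set V} -> F) (c : nat -> F)
    (X : {set V}) (r : nat) :
  (forall S : {set V}, S \subset X -> b S = c #|S|) ->
  (forall S : {set V}, (r < #|S|)%N -> b S = 0) ->
  ev b X = \sum_(d < r.+1) c d * 'C(#|X|, d)%:R.
Proof.
move=> bc b0; under [RHS]eq_bigr => d _.
  rewrite -cards_draws -sum1_card natr_sum mulr_sumr big_mkcond /=; over.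
rewrite exchange_big /ev big_mkcond; apply: eq_bigr => S _.
rewrite powersetE; case: ifP => sS; last first.
  by rewrite big1 // => d _; rewrite inE sS.
have [rS|Sr] := ltnP r #|S|.
  rewrite b0 // big1 // => d _; rewrite inE sS /=; case: eqP => // e.
  by have := ltn_ord d; rewrite ltnS -e leqNgt rS.
rewrite (bigD1 (Ordinal (Sr : #|S| < r.+1)%N)) //= inE sS eqxx mulr1 bc //.
rewrite big1 ?addr0 // => d ne; rewrite inE sS /=; case: eqP => // e.
by case/eqP: ne; apply: val_inj.
Qed.

(** * Coefficients of the restricted polynomial *)

Section Restrict.
Variables (F : realType) (n : nat) (f : {mpoly F[n]}) (Y0 Y1 : {set 'I_n}).
Hypotheses (mf : multilinear f) (dY : [disjoint Y0 & Y1]).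

Let W := ~: (Y0 :|: Y1).
Let a := coefs f.

Definition embed (S : {set 'I_#|W|}) : {set 'I_n} := [set enum_val j | j in S].

Definition trace (S : {set 'I_n}) : {set 'I_#|W|} := [set j | enum_val j \in S].

Lemma embed_sub S : embed S \subset W.
Proof. by apply/subsetP => i /imsetP[j _ ->]; exact: enum_valP. Qed.

Lemma embed_disjoint S (Y : {set 'I_n}) :
  Y \subset Y0 :|: Y1 -> [disjoint embed S & Y].
Proof.
move=> sY; rewrite disjoints_subset.
by apply: subset_trans (embed_sub S) _; rewrite setCS.
Qed.

Lemma card_embed S : #|embed S| = #|S|.
Proof. exact: card_imset enum_val_inj. Qed.

Lemma embedK S : trace (embed S) = S.
Proof.
apply/setP => j; rewrite inE; apply/imsetP/idP => [[j' jS /enum_val_inj ->] //|jS].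
by exists j.
Qed.

Lemma traceK (S : {set 'I_n}) : S \subset W -> embed (trace S) = S.
Proof.
move=> sS; apply/setP => i; apply/imsetP/idP => [[j]|iS].
  by rewrite inE => jS ->.
have iW := subsetP sS i iS.
by exists (enum_rank_in iW i); rewrite ?inE enum_rankK_in.
Qed.

(** A variable of Y0 in S kills the monomial, those of Y1 become 1, and the others are renamed. *)
Lemma restrict_monomial (S : {set 'I_n}) :
  'X_[F, set_mnm S] \mPo [tuple if i \in Y0 then 0
                else if i \in Y1 then 1
                else \sum_(j : 'I_#|W| | enum_val j == i) 'X_j | i < n]
  = (if [disjoint S & Y0] then 'X_[set_mnm (trace S)] else 0)
    :> {mpoly F[#|W|]}.
Proof.
rewrite comp_mpolyX; case: ifP => [d|]; last first.
  move=> /negbT; rewrite -setI_eq0 => /set0Pn[i]; rewrite inE => /andP[iS iY].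
  by rewrite (bigD1 i) //= tnth_mktuple iY mnmE iS expr1 mul0r.
rewrite (bigID (fun i => i \in W)) /= [X in _ * X]big1 ?mulr1; last first.
  move=> i; rewrite !inE negbK tnth_mktuple mnmE.
  case iS: (i \in S) => //; rewrite (disjointFr d iS) /= => ->.
  by rewrite expr1.
rewrite big_enum_val /= [RHS]mpolyXE_id; apply: eq_bigr => j _.
have := enum_valP j; rewrite tnth_mktuple !mnmE !inE negb_or => /andP[/negPf -> /negPf ->].
by rewrite (big_pred1 j) // => j' /=; rewrite (inj_eq enum_val_inj).
Qed.

Lemma restrictE : restrict Y0 Y1 f =
  \sum_(S : {set 'I_n} | [disjoint S & Y0]) a S *: 'X_[set_mnm (trace S)].
Proof.
rewrite /restrict {1}(multilinear_sum mf) raddf_sum /= [RHS]big_mkcond /=.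
apply: eq_bigr => S _; rewrite comp_mpolyZ restrict_monomial.
by case: ifP; rewrite ?scaler0.
Qed.

(** The monomials that become that of S are exactly those of [embed S :|: T] with T inside Y1. *)
Lemma restrict_coef (S : {set 'I_#|W|}) :
  coefs (restrict Y0 Y1 f) S = red a Y1 (embed S).
Proof.
rewrite /coefs restrictE raddf_sum /= /red.
under eq_bigr => T _ do rewrite mcoeffZ mcoeffX.
rewrite (bigID (fun T => trace T == S)) /= [X in _ + X]big1 ?addr0; last first.
  move=> T /andP[_ ne]; case: eqP => [e|]; last by rewrite mulr0.
  by rewrite -[trace T]set_mnmK e set_mnmK eqxx in ne.
have dE := embed_disjoint S (subsetUr Y0 Y1).
rewrite (reindex_onto (fun T => embed S :|: T) (fun T => T :&: Y1)) /=; last first.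
  move=> T /andP[dT /eqP <-].
  have -> : embed (trace T) = T :\: Y1.
    have sub : T :\: Y1 \subset W.
      apply/subsetP => i; rewrite !inE negb_or => /andP[-> iT].
      by rewrite (disjointFr dT iT).
    rewrite -[RHS]traceK //; congr embed; apply/setP => j; rewrite !inE.
    by have := enum_valP j; rewrite !inE negb_or => /andP[_ ->].
  by rewrite setUC setID.
apply: eq_big => [T|T /andP[/andP[_ /eqP ->] _]]; last by rewrite eqxx mulr1.
have trT : T \subset Y1 -> trace (embed S :|: T) = S.
  move=> sT; rewrite -[RHS]embedK; apply/setP => j; rewrite !inE.
  have := enum_valP j; rewrite !inE negb_or => /andP[_ nY1].
  by rewrite (contraNF (subsetP sT _) nY1) orbF.
rewrite powersetE; apply/andP/idP => [[_ /eqP <-]|sT]; first exact: subsetIr.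
rewrite trT // eqxx andbT setIUl (disjoint_setI0 dE) set0U (setIidPl sT) eqxx.
split=> //; rewrite -setI_eq0 setIUl setU_eq0 !setI_eq0.
rewrite (embed_disjoint S (subsetUl Y0 Y1)) /= disjoint_sym.
exact: disjointWr sT dY.
Qed.

Lemma restrict_multilinear : multilinear (restrict Y0 Y1 f).
Proof.
move=> m; apply: contraLR => nm; rewrite -mcoeff_eq0 restrictE raddf_sum /=.
rewrite big1 // => T _; rewrite mcoeffZ mcoeffX; case: eqP => [e|].
  by rewrite -e set_mnm_multilinear in nm.
by rewrite mulr0.
Qed.

Lemma restrict_degree r : degree_le r f -> degree_le r (restrict Y0 Y1 f).
Proof.
move=> df; rewrite /degree_le msizeE; apply/bigmax_leqP_seq => m mm _.
rewrite ltnS leqNgt; apply: contraL mm => rm.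
have [ml|nml] := boolP (multilinear_mnm m); last first.
  by apply: contra nml; exact: restrict_multilinear.
rewrite -mcoeff_eq0 -(mnm_setK ml).
have := restrict_coef (mnm_set m); rewrite /coefs => ->.
apply/eqP/(red_deg (r := r)).
  by move=> S; apply: coefs_deg.
by rewrite card_embed -mdeg_set_mnm mnm_setK.
Qed.

End Restrict.

(** * Return to polynomials, and the case of small k *)

Lemma structured_constantly (F : realType) (n k r C : nat) (f : {mpoly F[n]}) (l : F) :
  multilinear f -> degree_le r f -> structured setT k (coefs f) l C ->
  exists Y0 Y1 : {set 'I_n},
    [/\ [disjoint Y0 & Y1], (#|Y0| <= C)%N /\ (#|Y1| <= C)%N,
      (#|Y1| <= k)%N /\ (k - #|Y1| <= n - #|Y0| - #|Y1|)%N &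
      constantly r (k - #|Y1|) l (restrict Y0 Y1 f)].
Proof.
move=> mf df [Y [Y1 [sY1 _ cY cY1 [[c cE] [X Xs eX]]]]].
have YE : (Y :\: Y1) :|: Y1 = Y by rewrite setUC -{1}(setIidPr sY1) setID.
have dY : [disjoint Y :\: Y1 & Y1].
  by rewrite -setI_eq0 setIDAC setDIl setDv setI0.
move: Xs; rewrite inE setTD => /andP[sX /eqP cX].
(* The fixed variables outside Y1 are set to 0. *)
exists (Y :\: Y1), Y1; split => //.
- split; apply: leq_trans cY; last exact: subset_leq_card.
  by apply: subset_leq_card; exact: subsetDl.
(* The point X of the remaining slice has k - |Y1| elements, which must fit among the remaining
   variables. *)
- split => //; rewrite -cX; apply: leq_trans (subset_leq_card sX) _.
  rewrite cardsCs setCK card_ord cardsDS // -subnDA subnK //.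
  exact: subset_leq_card.
split; [exact: restrict_multilinear|exact: restrict_degree|].
exists c; split => [d dr m ml <-|].
  rewrite -(mnm_setK ml) mdeg_set_mnm -card_embed.
  have := restrict_coef mf dY (mnm_set m); rewrite /coefs => ->.
  apply: cE; rewrite setTD; apply: subset_trans (embed_sub _) _.
  by rewrite YE.
rewrite -cX -eX; apply/esym/ev_constant.
  by move=> S sS; apply: cE; rewrite setTD (subset_trans sS).
by move=> S; apply: red_deg => S'; exact: coefs_deg.
Qed.

Lemma slice_prob_ev (F : realType) (n k : nat) (f : {mpoly F[n]}) (l : F) :
  multilinear f ->
  slice_prob F n k (fun x => eval01 f x == l) =
  (\sum_(X in slc [set: 'I_n] k) (ev (coefs f) X == l)%:R) / #|slc [set: 'I_n] k|%:R.
Proof.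
move=> mf; pose ind (X : {set 'I_n}) : {ffun 'I_n -> bool} := [ffun i => i \in X].
have indK : cancel ind (fun x : {ffun 'I_n -> bool} => [set i | x i]).
  by move=> X; apply/setP => i; rewrite inE ffunE.
have indK' : cancel (fun x : {ffun 'I_n -> bool} => [set i | x i]) ind.
  by move=> x; apply/ffunP => i; rewrite ffunE inE.
have sum (P : pred {ffun 'I_n -> bool}) : #|[set x in slice n k | P x]|%:R =
    \sum_(X in slc [set: 'I_n] k) (P (ind X))%:R :> F.
  rewrite (@card_set_sum F _ (fun x => (x \in slice n k) && P x)).
  rewrite (reindex ind) /=; last by exists (fun x => [set i | x i]) => x _.
  rewrite [RHS]big_mkcond; apply: eq_bigr => X _.
  by rewrite !inE subsetT indK; case: (_ == k).
rewrite /slice_prob sum; congr (_ / _); last first.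
  have := sum predT; rewrite -natr_sum sum1_card => <-.
  by congr (_%:R); apply: eq_card => x; rewrite !inE andbT.
by apply: eq_bigr => X _; rewrite eval01E // indK.
Qed.

(** Every variable is fixed as X prescribes, so that only the empty monomial is left. This serves
    for bounded n. *)
Lemma structured_point (F : realType) (n k : nat) (a : {set 'I_n} -> F)
    (X : {set 'I_n}) (l : F) :
  #|X| = k -> ev a X = l -> structured setT k a l n.
Proof.
move=> cX eX; exists setT, X; rewrite cX subnn setDv cardsT card_ord.
split; rewrite ?subsetT ?leqnn //; split.
  by exists (fun=> red a X set0) => S; rewrite subset0 => /eqP ->.
exists set0; first by rewrite inE sub0set cards0.
by rewrite ev_red ?set0U // disjoints_subset sub0set.
Qed.

Lemma structured_le (F : realType) (V : finType) (W : {set V}) k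
    (a : {set V} -> F) l C C' :
  (C <= C')%N -> structured W k a l C -> structured W k a l C'.
Proof.
move=> CC' [Y [Y1 [s1 s cY c1 h]]]; exists Y, Y1; split => //.
exact: leq_trans CC'.
Qed.

Theorem theorem7p2 (F : realType) (r q R : nat) (K0 eps : F) :
  0 < K0 -> 0 < eps ->
  exists C' : nat,
    forall (n k : nat) (f : {mpoly F[n]}),
      3%:R * k%:R - K0 <= n%:R ->
      n%:R <= R%:R * k%:R + K0 ->
      multilinear f ->
      degree_le r f ->
      (forall m : 'X_{1..n}, f@_m \is a Num.int /\ `|f@_m| <= q%:R) ->
      forall l : F,
        slice_prob F n k (fun x => eval01 f x == l) <= eps
        \/
        exists Y0 Y1 : {set 'I_n},
          [/\ [disjoint Y0 & Y1],
              (#|Y0| <= C')%N /\ (#|Y1| <= C')%N,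
              (* 0 <= k - |Y1| <= n - |Y0| - |Y1| *)
              (#|Y1| <= k)%N /\ (k - #|Y1| <= n - #|Y0| - #|Y1|)%N &
              constantly r (k - #|Y1|) l (restrict Y0 Y1 f)].
Proof.
move=> K00 e0; have [K K0K] := archi_nat K0.
(* The ratio [R.+1] comes from n <= R k + K <= (R + 1) k for k >= K. *)
have [C [k0 H]] := @dichotomy_all F r q R.+1 eps e0 isT.
(* The second term bounds n when k < k0 + K; all variables are then fixed. *)
exists (C + (R * (k0 + K) + K))%N => n k f le3 leR mf df cf l.
have nR : (n <= R * k + K)%N.
  rewrite -(ler_nat F) natrD natrM; apply: le_trans leR _; lra.
have n3 : (3 * k <= n + K)%N.
  by rewrite -(ler_nat F) natrD natrM; lra.
have [le|gt] := lerP (slice_prob F n k (fun x => eval01 f x == l)) eps; [by left|right].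
apply: structured_constantly => //.
(* On an empty slice the probability is 0 by the division convention, hence not above eps. *)
have N0 : 0 < #|slc [set: 'I_n] k|%:R :> F.
  rewrite lt0r ler0n andbT; apply: contraTneq gt => N0.
  by rewrite slice_prob_ev // N0 invr0 mulr0 -leNgt ltW.
move: gt; rewrite slice_prob_ev // ltr_pdivlMr // => gt.
have [kk|kk] := leqP (k0 + K) k.
  apply: (@structured_le F _ _ _ _ _ C); first exact: leq_addr.
  apply: H gt.
  - by move=> S; have [] := cf (set_mnm S).
  - by move=> S; have [] := cf (set_mnm S).
  - by move=> S; exact: coefs_deg.
  - exact: vanish_high.
  - by apply: leq_trans kk; exact: leq_addr.
  - by rewrite cardsT card_ord; lia.
  (* Here n >= 3 k - K >= 2 k gives k <= n - k. *)
  - rewrite cardsT card_ord; apply: (@leq_trans (R.+1 * k)%N); first lia.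
    by rewrite leq_mul2l /=; lia.
have [X Xs /eqP eX] := positive_hit (phi := fun X => ev (coefs f) X == l) e0 gt.
apply: (@structured_le F _ _ _ _ _ n); last first.
  by apply: structured_point eX; move: Xs; rewrite inE => /andP[_ /eqP].
apply: leq_trans (leq_addl _ _); apply: leq_trans nR _.
by rewrite leq_add2r leq_mul2l (ltnW kk) orbT.
Qed.
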